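(* Fix $W>0$. Let $h:\mathbb R\to(0,\infty)$ be known and continuous, and suppose that known constants $\underline h,\overline h$ satisfy $0<\underline h\le h(y)\le\overline h<\infty$ for every $y\in\mathbb R$. Consider the family of systems $$y_{t+1}=a\,h(y_t)\phi_b(y_t)+u_t+w_{t+1},\qquad t\ge0,\quad a\in\mathbb R,\ b>0,$$ with disturbances satisfying $\sup_{t\ge1}|w_t|\le W$. (1) For every nonempty compact parameter set $\mathcal P\subset\mathbb R\times(0,\infty)$ whose largest exponent $\max\{b:(a,b)\in\mathcal P\}$ is at most $3\sqrt3/2$, there is a feedback law (a single one, not depending on $Y$) such that for every $Y\ge0$ $$\sup_{\substack{p^\star\in\mathcal P,\ |y_0|\le Y\\ (w_k)_{k\ge1}:\ \sup_k|w_k|\le W}}\ \sup_{t\ge0}|y_t|<\infty .$$ (2) A point $p_0=(a_0,b_0)\in\mathbb R\times(0,\infty)$ is locally robustly stabilizable for this family if and only if $b_0<3\sqrt3/2$. (3) If $b_0>3\sqrt3/2$, then for every compact rectangle $Q\subset\mathbb R\times(0,\infty)$ with $p_0=(a_0,b_0)\in\operatorname{int}Q$, every feedback law and every $R_0>0$, there exist $p^\star\in Q$, $y_0\ge R_0$, a disturbance sequence $(w_t)_{t\ge1}$ with $\sup_{t\ge1}|w_t|\le W$, constants $c>0$ and $z>1$, and $T_0\in\mathbb N$ such that the resulting closed-loop trajectory of this family with true parameter $p^\star$ satisfies $\log|y_t|\ge cz^t$ for every $t\ge T_0$; in particular $\sup_{t\ge0}|y_t|=\infty$.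
   Context: For $b>0$ and $y\in\mathbb R$, $\phi_b(y)=\operatorname{sgn}(y)|y|^b$ (so $\phi_b(0)=0$). The state is $y_t\in\mathbb R$, the input is $u_t\in\mathbb R$, and the true parameter $p^\star=(a^\star,b^\star)\in\mathbb R\times(0,\infty)$ is unknown to the controller; trajectories are generated by $y_{t+1}=a^\star h(y_t)\phi_{b^\star}(y_t)+u_t+w_{t+1}$. A feedback law is a sequence $\mu=(\mu_t)_{t\ge0}$ of maps $\mu_t:\mathbb R^{t+1}\to\mathbb R$ (no regularity required) with $u_t=\mu_t(y_0,\ldots,y_t)$; it may depend on the prescribed parameter set, on $W$ and on the known function $h$, but not on $p^\star$ or the disturbances. A nonempty set $\mathcal P\subset\mathbb R\times(0,\infty)$ is robustly stabilizable (for this family) if there is a feedback law such that $\sup_{t\ge0}|y_t|<\infty$ for every $p^\star\in\mathcal P$, every $y_0\in\mathbb R$, and every disturbance sequence with $\sup_{t\ge1}|w_t|\le W$. A compact rectangle is a product of two compact intervals. A point $p_0\in\mathbb R\times(0,\infty)$ is locally robustly stabilizable (for this family) if there is a compact rectangle $Q\subset\mathbb R\times(0,\infty)$ with $p_0\in\operatorname{int}Q$ that is robustly stabilizable. *)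

(* Defs.v *)
From HB Require Import structures.
From mathcomp Require Import all_boot all_order all_algebra.
From mathcomp Require Import all_classical all_reals all_analysis.

Set Implicit Arguments.
Unset Strict Implicit.
Unset Printing Implicit Defensive.

Import Order.TTheory GRing.Theory Num.Theory.
Import numFieldNormedType.Exports.

Local Open Scope classical_set_scope.
Local Open Scope ring_scope.

Definition phi (R : realType) (b y : R) : R := Num.sg y * `|y| `^ b.

(* A parameter is a pair p = (a, b), with p.1 = a the gain and p.2 = b the
   exponent. *)
Definition param_space (R : realType) : set (R * R) := [set p | 0 < p.2].

(* 'I_t.+1 -> R plays the role of R^(t+1): the law at time t sees exactly the
   values y_0, ..., y_t. *)
Definition feedback_law (R : realType) : Type :=
  forall t : nat, ('I_t.+1 -> R) -> R.

(* Disturbances are indexed from 1; the value w 0 is never used. *)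
Definition admissible_disturbance (R : realType) (W : R) (w : nat -> R) : Prop :=
  forall t : nat, (1 <= t)%N -> `|w t| <= W.

(* Given mu, p, w and the initial state y 0, exactly one y satisfies this. *)
Definition closed_loop (R : realType) (h : R -> R) (mu : feedback_law R)
    (p : R * R) (w y : nat -> R) : Prop :=
  forall t : nat,
    y t.+1 = p.1 * h (y t) * phi p.2 (y t)
             + mu t (fun i : 'I_t.+1 => y i) + w t.+1.

Definition sup_abs (R : realType) (y : nat -> R) : \bar R :=
  ereal_sup (range (fun t : nat => `|y t|%:E)).

Definition trajectories (R : realType) (W : R) (h : R -> R)
    (mu : feedback_law R) (P : set (R * R)) (Y : R) : set (nat -> R) :=
  [set y | `|y 0%N| <= Y /\
     exists p w, [/\ P p, admissible_disturbance W w & closed_loop h mu p w y]].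

Definition robustly_stabilizable (R : realType) (W : R) (h : R -> R)
    (P : set (R * R)) : Prop :=
  exists mu : feedback_law R,
    forall (p : R * R) (y0 : R) (w y : nat -> R),
      P p -> admissible_disturbance W w ->
      y 0%N = y0 -> closed_loop h mu p w y ->
      (sup_abs y < +oo)%E.

Definition compact_rectangle (R : realType) (Q : set (R * R)) : Prop :=
  exists a1 a2 b1 b2 : R,
    [/\ a1 <= a2, b1 <= b2 & Q = `[a1, a2] `*` `[b1, b2]].

Definition locally_robustly_stabilizable (R : realType) (W : R) (h : R -> R)
    (p0 : R * R) : Prop :=
  exists Q : set (R * R),
    [/\ compact_rectangle Q, Q `<=` param_space (R := R), interior Q p0 &
        robustly_stabilizable W h Q].

(* Main.v *)
Require Import Defs.
From HB Require Import structures.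
From mathcomp Require Import all_boot all_order all_algebra.
From mathcomp Require Import all_classical all_reals all_analysis.
From mathcomp Require Import ring lra zify.

Set Implicit Arguments.
Unset Strict Implicit.
Unset Printing Implicit Defensive.

Import Order.TTheory GRing.Theory Num.Theory.
Import numFieldNormedType.Exports.

Local Open Scope classical_set_scope.
Local Open Scope ring_scope.

(** Write c = 3 sqrt 3 / 2 and measure states on the logarithmic scale
    x_t = ln (max 1 |y_t|).  A transition out of y_s reveals a h(y_s) phi_b(y_s)
    up to W, that is, the affine function x |-> ln |a| + b x at x = x_s up to
    an error of order exp (- b x_s).  Two unknowns require two such readings,
    and extrapolating from x_(t-2) and x_(t-1) to x_t leaves an uncertainty of
    order exp (b (x_t - x_(t-2))) on the next state.  Hence the law of the game
    is x_(t+1) = b (x_t - x_(t-2)), whose characteristic equation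
    z^3 = b (z^2 - 1) has a root z > 1 exactly when b >= c: the function
    z^3 / (z^2 - 1) has its minimum on z > 1 at z = sqrt 3, with value c.

    Stabilization for exponents at most c.  At b = c the double root sqrt 3
    would still allow growth, so the feedback has to break the tie.  It is a
    certainty-equivalence law that always trusts the LARGEST exponent compatible
    with the data ([largest_exponent_law]).  Then the estimate never lies below
    the true exponent b*, nor above c, and two cases remain.  If b* <= c - eps,
    the extrapolation error is at most
      exp (b* (x_(t-1) - x_(t-2)) + c (x_t - x_(t-1)))
    ([expsum_extrapolate]), which adds the damping - eps (x_(t-1) - x_(t-2)) to
    the recursion; the damped characteristic polynomial has no positive root, so
    the number of successive records is bounded ([milestones_count],
    [bounded_of_slow_steps]).  If b* is extremely close to c, the estimated
    exponent, squeezed between b* and c, is as good as exact while the state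
    stays below a given bound; only the gain is then uncertain and the recursion
    improves to x_(t+1) = c (x_t - x_(t-1)), whose critical exponent is 4.  This
    is damped enough to keep the state below a bound B fixed beforehand
    ([slow_step_of_close]); choosing eps small in terms of B makes the two cases
    overlap, and yields a bound uniform over the parameter set.

    Destabilization above c.  The adversary keeps a current parameter and, at
    each time, either leaves it unchanged or rotates the line ln |a| + b x about
    the point x_(t-1), by an amount so small that every earlier observation can
    still be explained by an admissible disturbance.  The two options predict
    values of y_(t+1) that differ by about exp (b (x_t - x_(t-2))), so whatever
    the input is, one of them makes |y_(t+1)| at least half of that, and
    x_(t+1) >= sqrt 3 x_t follows ([adversary_invariantP]).  The parameters
    converge to one that explains the whole trajectory ([adversarial_limit],
    [adversary_wins]).  Since this happens in any neighbourhood of a parameter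
    with exponent above c, no neighbourhood of a parameter with exponent at least
    c can be robustly stabilized. *)

(** * The critical recursion *)

Lemma sqrt3_gt0 (R : realType) : 0 < Num.sqrt 3 :> R.
Proof. by rewrite sqrtr_gt0. Qed.

Lemma sqrt3_sqr (R : realType) : Num.sqrt 3 * Num.sqrt 3 = 3 :> R.
Proof. by rewrite -expr2 sqr_sqrtr. Qed.

Lemma sqrt3_bounds (R : realType) : 17 / 10 < (Num.sqrt 3 : R) < 7 / 4.
Proof.
have s0 := sqrt3_gt0 R; have ss := sqrt3_sqr R.
by apply/andP; split; nra.
Qed.

(** Here r lists successive record levels, starting from the level 0, and n is
    their number.  The last clause is the characteristic recursion
    r_(i+3) = b (r_(i+2) - r_i), damped by eps and perturbed by k and C. *)
Definition milestones (R : realType) (b eps k C X : R) (n : nat) (r : nat -> R)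
    : Prop :=
  [/\ r 0%N = 0,
      forall i, (i.+1 < n)%N -> r i + 1 < r i.+1,
      (1 < n)%N -> r 1%N <= X,
      forall i, (0 < i)%N -> (i.+1 < n)%N -> r i.+1 <= b * r i + C
    & forall i, (i.+3 < n)%N ->
        r i.+3 <= b * r i.+2 - eps * r i.+1 - (b - eps) * r i + k * r i.+2 + C].

Lemma milestones_ge_index (R : realType) (b eps k C X : R) n r :
  milestones b eps k C X n r -> forall i, (i < n)%N -> i%:R <= r i.
Proof.
case=> r0 gap _ _ _; elim=> [|i IH] lt_in; first by rewrite r0.
have := gap i lt_in; have := IH (ltnW lt_in).
by rewrite -natr1; lra.
Qed.

(** In the recursion e2 = sg e1 - tau e0 the ratio of consecutive terms is mapped
    by rho |-> sg - tau / rho.  When the discriminant sg^2 - 4 tau is negative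
    this map lies below the diagonal, so the ratio drops by a fixed amount. *)
Lemma ratio_step (R : realType) (sg tau del e0 e1 e2 rho : R) :
  del = tau - sg ^+ 2 / 4 -> 0 < del -> 0 < e0 -> 0 < e1 -> rho <= 5 ->
  e1 <= rho * e0 -> e2 <= (sg + del / 10) * e1 - tau * e0 ->
  e2 <= (rho - del / 10) * e1.
Proof.
move=> delE del0 e00 e10 rho5 h1 h2.
have tau0 : 0 < tau by have := sqr_ge0 sg; lra.
have rho0 : 0 < rho.
  by rewrite -(pmulr_lgt0 _ e00); exact: lt_le_trans h1.
rewrite -(ler_pM2l rho0).
have h3 : rho * e2 <= rho * ((sg + del / 10) * e1 - tau * e0).
  by rewrite ler_pM2l.
have h4 : tau * e1 <= tau * (rho * e0) by rewrite ler_pM2l.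
have h5 : 0 <= rho ^+ 2 - sg * rho + tau - del.
  have -> : rho ^+ 2 - sg * rho + tau - del = (rho - sg / 2) ^+ 2.
    by rewrite delE; field.
  exact: sqr_ge0.
have h6 : rho * (del / 5) <= del by nra.
have h7 : 0 <= (rho ^+ 2 - sg * rho + tau - rho * (del / 5)) * e1.
  by apply: mulr_ge0; lra.
lra.
Qed.

(** The polynomial z^3 - c z^2 + c factors as (z + s/2) (z - s)^2 with s = sqrt 3.
    Damping replaces it by z^3 - c z^2 + eps z + (c - eps), which splits the
    double root into a complex pair.  Factoring up to an inequality suffices, as
    the levels are nonnegative: (z + nu) (z^2 - sg z + tau) agrees with the
    damped cubic in degrees 2 and 1, and its constant term is at most c - eps. *)
Lemma perturbed_cubic (R : realType) (eps : R) : 0 < eps <= 1 ->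
  exists nu sg tau : R,
    [/\ 0 < nu < 1, sg = 3 * Num.sqrt 3 / 2 + nu, tau = sg * nu + eps,
        tau * nu <= 3 * Num.sqrt 3 / 2 - eps & 0 < tau - sg ^+ 2 / 4].
Proof.
move=> /andP[eps0 eps1].
have ss := sqrt3_sqr R; have /andP[sl su] := sqrt3_bounds R.
move: (Num.sqrt 3) ss sl su => s ss sl su.
have [th epsE] : exists th, eps = 3 * th by exists (eps / 3); lra.
have th0 : 0 < th by lra.
have th1 : th <= 1 / 3 by lra.
(* To first order in eps, the bound on tau nu asks for a shift th of the root
   - s/2 of at least 0.277 eps, and a negative discriminant for a shift below
   0.384 eps. *)
have sth : s * th < 7 / 4 * th by rewrite ltr_pM2r.
exists (s / 2 - th), (2 * s - th).
have tauE : (2 * s - th) * (s / 2 - th) + eps =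
    3 - 5 / 2 * (s * th) + th * th + 3 * th by rewrite epsE; lra.
exists (3 - 5 / 2 * (s * th) + th * th + 3 * th); split.
- by apply/andP; split; lra.
- by lra.
- by rewrite tauE.
- have -> : (3 - 5 / 2 * (s * th) + th * th + 3 * th) * (s / 2 - th) =
      3 * s / 2 - 5 / 4 * (s * s) * th + 5 / 2 * s * th * th - 3 * th
      + th * th * s / 2 - th * th * th + 3 / 2 * s * th - 3 * th * th by field.
  rewrite ss.
  suff : 0 <= th * (15 / 4 - 3 / 2 * s - 3 * (s * th) + 3 * th + th * th) by lra.
  apply: mulr_ge0; first exact: ltW.
  have := mulr_ge0 (ltW th0) (ltW th0); lra.
- have -> : 3 - 5 / 2 * (s * th) + th * th + 3 * th - (2 * s - th) ^+ 2 / 4 =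
      3 * th - 3 / 2 * (s * th) + 3 / 4 * (th * th) + (3 - s * s) by field.
  have := mulr_ge0 (ltW th0) (ltW th0); lra.
Qed.

(** Along milestones the combination r_(i+1) + nu r_i obeys, up to a perturbation
    absorbed by del, the quadratic recursion of [ratio_step].  The index K is
    where the levels dominate the constant C; from there on, crude growth gives
    the initial ratio 5. *)
Lemma ratio_decrease (R : realType) (b eps C nu sg tau del : R) (n K : nat)
    (X : R) (r : nat -> R) :
  0 < eps <= 1 -> 1 <= b <= 3 -> 0 < nu < 1 -> sg = b + nu -> tau = sg * nu + eps ->
  tau * nu <= b - eps -> del = tau - sg ^+ 2 / 4 -> 0 < del ->
  C <= K%:R -> C <= del / 20 * K%:R ->
  milestones b eps (del / 20) C X n r ->
  forall j, (K + j + 3 < n)%N ->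
    r (K + j).+3 + nu * r (K + j).+2 <=
      (5 - j%:R * (del / 10)) * (r (K + j).+2 + nu * r (K + j).+1).
Proof.
move=> /andP[e0 e1] /andP[b1 b3] /andP[nu0 nu1] sgE tauE taunu delE del0 CK CdK mr.
have idx := milestones_ge_index mr.
case: mr => _ gap _ grow rec.
have rpos i : (i < n)%N -> 0 <= r i by move=> /idx; apply: le_trans.
have Epos i : (i.+1 < n)%N -> 0 < r i.+1 + nu * r i.
  move=> lt_in; have g := gap i lt_in; have ri := rpos i (ltnW lt_in).
  have h : 0 <= nu * r i by apply: mulr_ge0 => //; exact: ltW.
  by move: g ri h; clear; lra.
elim=> [|j IH] ltj.
  rewrite addn0 in ltj *; rewrite mul0r subr0.
  have K2n : (K.+2 < n)%N by move: ltj; clear; lia.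
  have K3n : (K.+3 < n)%N by move: ltj; clear; lia.
  have g := grow K.+2 isT K3n.
  have i2 := le_trans CK (le_trans _ (idx K.+2 K2n)).
  have {}i2 : C <= r K.+2 by apply: i2; rewrite ler_nat; clear; lia.
  have p1 := rpos K.+1 (ltnW K2n); have p2 := rpos K.+2 K2n.
  have nr : 0 <= nu * r K.+1 by apply: mulr_ge0 => //; exact: ltW.
  have n2 : nu * r K.+2 <= r K.+2 by apply: ler_piMl => //; exact: ltW.
  have n3 : b * r K.+2 <= 3 * r K.+2 by rewrite ler_wpM2r.
  by move: g i2 p2 nr n2 n3; clear; lra.
have lt5 : ((K + j).+4 < n)%N by move: ltj; clear; lia.
have lt4 : ((K + j).+3 < n)%N := ltnW lt5.
have {}IH := IH ltac:(move: ltj; clear; lia).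
rewrite addnS.
have -> : 5 - j.+1%:R * (del / 10) = (5 - j%:R * (del / 10)) - del / 10.
  by rewrite -natr1; ring.
have p1 := rpos (K + j).+1 (ltnW (ltnW lt4)).
have p2 := rpos (K + j).+2 (ltnW lt4).
have p3 := rpos (K + j).+3 lt4.
have jd : 0 <= j%:R * (del / 10) by apply: mulr_ge0; rewrite ?ler0n // divr_ge0 ?ltW.
apply: (@ratio_step R sg tau del (r (K + j).+2 + nu * r (K + j).+1)) => //.
- exact: Epos (ltnW lt4).
- exact: Epos.
- by move: jd; clear; lra.
have rc := rec (K + j).+1 lt5.
have Ck : C <= del / 20 * r (K + j).+3.
  apply: (le_trans CdK); rewrite ler_pM2l; last by rewrite divr_gt0.
  by apply: le_trans (idx _ lt4); rewrite ler_nat; clear; lia.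
have q1 : 0 <= (b - eps - tau * nu) * r (K + j).+1.
  by apply: mulr_ge0 => //; rewrite subr_ge0.
have q2 : 0 <= del / 10 * (nu * r (K + j).+2).
  by apply: mulr_ge0; [rewrite divr_ge0 ?ltW | apply: mulr_ge0 => //; exact: ltW].
have -> : (sg + del / 10) * (r (K + j).+3 + nu * r (K + j).+2)
    - tau * (r (K + j).+2 + nu * r (K + j).+1) =
   (sg + del / 10) * r (K + j).+3
   + (sg * nu - tau) * r (K + j).+2 + del / 10 * (nu * r (K + j).+2)
   - tau * nu * r (K + j).+1 by clear; ring.
have -> : sg * nu - tau = - eps by rewrite tauE; ring.
rewrite sgE.
by move: rc Ck q1 q2; clear; lra.
Qed.

(** The ratio of the positive numbers r_(i+1) + nu r_i decreases by a fixed amount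
    at each milestone, so that there cannot be more than a fixed number of them.
    The bound does not depend on the size X of the first milestone. *)
Lemma milestones_count (R : realType) (eps : R) : 0 < eps <= 1 ->
  exists2 k : R, 0 < k & forall C : R, 0 <= C -> exists N : nat, forall X n r,
    milestones (3 * Num.sqrt 3 / 2) eps k C X n r -> (n <= N)%N.
Proof.
move=> e01; have [nu [sg [tau [nu01 sgE tauE taunu]]]] := perturbed_cubic e01.
have b13 : 1 <= (3 * Num.sqrt 3 / 2 : R) <= 3.
  by have /andP[sl su] := sqrt3_bounds R; apply/andP; split; lra.
set del := _ - _ => del0.
exists (del / 20); first by rewrite divr_gt0.
move=> C C0.
have [K [CK CdK]] : exists K : nat, C <= K%:R /\ C <= del / 20 * K%:R.
  have q0 : 0 <= C / (del / 20) by rewrite !divr_ge0 // ltW.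
  have := archi_boundP (addr_ge0 C0 q0); set K := Num.Def.archi_bound _ => bd.
  exists K; split; first by move: bd q0; clear; lra.
  rewrite mulrC -ler_pdivrMr ?divr_gt0 //.
  by move: bd C0; clear; lra.
have [J J5] : exists J : nat, 5 <= J%:R * (del / 10).
  exists (Num.Def.archi_bound (5 / (del / 10))).
  rewrite -ler_pdivrMr ?divr_gt0 //.
  by apply/ltW/archi_boundP; rewrite !divr_ge0 // ltW.
exists (K + J + 4)%N => X n r mr.
rewrite leqNgt; apply/negP => ltn.
have lt3 : (K + J + 3 < n)%N by move: ltn; clear; lia.
have := ratio_decrease e01 b13 nu01 sgE tauE taunu erefl del0 CK CdK mr lt3.
have idx := milestones_ge_index mr.
have pos i : (i < n)%N -> 0 <= r i by move=> /idx; apply: le_trans.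
have p3 : 1 <= r (K + J).+3.
  by apply: le_trans (idx _ _); rewrite ?ler1n //; move: lt3; clear; lia.
have p2 : 0 <= r (K + J).+2 by apply: pos; move: lt3; clear; lia.
have p1 : 0 <= r (K + J).+1 by apply: pos; move: lt3; clear; lia.
case/andP: nu01 => nu0 _.
apply/negP; rewrite -ltNge.
have q2 : 0 <= nu * r (K + J).+2 by rewrite mulr_ge0 // ltW.
have q1 : 0 <= nu * r (K + J).+1 by rewrite mulr_ge0 // ltW.
apply: (@le_lt_trans _ _ 0); last by move: p3 q2; clear; lra.
by apply: mulr_le0_ge0; [rewrite subr_le0 | exact: addr_ge0].
Qed.

Definition extend (R : realType) (r : nat -> R) (m : nat) (v : R) (i : nat) : R :=
  if i == m then v else r i.

Lemma extend_last (R : realType) (r : nat -> R) m v : extend r m v m = v.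
Proof. by rewrite /extend eqxx. Qed.

Lemma extend_below (R : realType) (r : nat -> R) m v i :
  (i < m)%N -> extend r m v i = r i.
Proof. by rewrite /extend => h; rewrite ltn_eqF. Qed.

Lemma milestones_extend (R : realType) (b eps k C X : R) n r v :
  milestones b eps k C X n.+1 r -> r n + 1 < v ->
  (n = 0%N -> v <= X) -> ((0 < n)%N -> v <= b * r n + C) ->
  (forall i, n = i.+2 ->
     v <= b * r n - eps * r i.+1 - (b - eps) * r i + k * r n + C) ->
  milestones b eps k C X n.+2 (extend r n.+1 v).
Proof.
move=> [r0 gap first grow rec] nv vX vg vr.
split.
- by rewrite extend_below.
- move=> i; rewrite ltnS leq_eqVlt => /orP[/eqP [->]|h].
    by rewrite extend_last extend_below.
  by rewrite !extend_below //; [exact: gap | exact: ltnW].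
- move=> _; case: n nv vX {vg vr} gap first grow rec => [|n] nv vX gap first grow rec.
    by rewrite extend_last; exact: vX.
  by rewrite extend_below //; apply: first.
- move=> i i0; rewrite ltnS leq_eqVlt => /orP[/eqP [ni]|h].
    by rewrite ni extend_last extend_below //; apply: vg; rewrite -ni.
  by rewrite !extend_below //; [exact: grow | exact: ltnW].
- move=> i; rewrite ltnS leq_eqVlt => /orP[/eqP [ni]|h].
    by rewrite -ni extend_last !extend_below //; [rewrite ni; exact: vr | lia..].
  by rewrite !extend_below //; [exact: rec | lia..].
Qed.

Lemma milestones_le_geometric (R : realType) (b eps k C X : R) n r :
  0 <= b -> 0 <= C -> 1 <= b + C -> 0 <= X -> milestones b eps k C X n r ->
  forall i, (i < n)%N -> r i <= X * (b + C) ^+ i.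
Proof.
move=> b0 C0 bC1 X0 mr; have idx := milestones_ge_index mr.
case: mr => r0 gap first grow _; elim=> [|[|i] IH] lt_in.
- by rewrite r0 mulr_ge0.
- apply: (le_trans (first lt_in)); rewrite expr1.
  by rewrite -[leLHS]mulr1; apply: ler_wpM2l.
- have {}IH := IH (ltnW lt_in).
  have ri1 : 1 <= r i.+1.
    by apply: le_trans (idx _ (ltnW lt_in)); rewrite ler1n.
  apply: (le_trans (grow i.+1 _ lt_in)) => //.
  rewrite exprS mulrCA.
  have : (b + C) * r i.+1 <= (b + C) * (X * (b + C) ^+ i.+1).
    by apply: ler_wpM2l => //; lra.
  by apply: le_trans; rewrite mulrDl lerD2l ler_peMr.
Qed.

(** The level 0 is a datum at all times: parameters range over a bounded set, so
    that their predictions at |y| = 1 differ by a bounded amount. *)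
Definition datum (R : realType) (x : nat -> R) (t : nat) (p : R) : Prop :=
  p = 0 \/ exists2 s, (s < t)%N & p = x s.

(** The three ways in which knowledge bounds the next level: without any reading;
    when the current level x t lies beyond two separated readings p < q; and when
    it does not exceed q by more than 1.  The separation p + 1 <= q keeps the
    readings informative, and the term k x t hides logarithmic factors. *)
Definition slow_step (R : realType) (b eps k C : R) (x : nat -> R) (t : nat) : Prop :=
  [/\ x t.+1 <= b * x t + C,
      forall p q, datum x t p -> datum x t q -> p + 1 <= q -> q <= x t ->
        x t.+1 <= b * (x t - p) - eps * (q - p) + k * x t + C
    & forall p q, datum x t p -> datum x t q -> p + 1 <= q -> x t <= q + 1 ->
        x t.+1 <= b * (q - p) + k * q + C].

Lemma datumS (R : realType) (x : nat -> R) t p : datum x t p -> datum x t.+1 p.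
Proof. by case=> [->|[s st ->]]; [left | right; exists s => //; exact: ltnW]. Qed.

(** A new level counts as a milestone when it exceeds the previous milestone by
    more than 1.  A milestone reached right after another one is controlled by the
    second clause of [slow_step], with p and q the two milestones before it; a
    milestone reached later is controlled by the third clause, which is even
    stronger.  By [milestones_count] there are few milestones, and levels cannot
    exceed the last milestone by more than 1. *)
Lemma bounded_of_slow_steps (R : realType) (eps : R) : 0 < eps <= 1 ->
  exists2 k : R, 0 < k & forall C X : R, 0 <= C -> 0 <= X ->
    exists2 B : R, 0 <= B & forall (x : nat -> R) (T : nat),
      (forall t, 0 <= x t) -> x 0%N <= X ->
      (forall t, (t < T)%N -> slow_step (3 * Num.sqrt 3 / 2) eps k C x t) ->
      forall t, (t <= T)%N -> x t <= B.
Proof.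
move=> e01; have [k k0 count] := milestones_count e01.
case/andP: e01 => e0 e1.
have /andP[sl su] := sqrt3_bounds R.
set b := 3 * Num.sqrt 3 / 2 in count *.
have b1 : 1 <= b by rewrite /b; lra.
exists k => // C X C0 X0.
pose C' := b + C; pose X' := X + b + C.
have C'0 : 0 <= C' by rewrite /C'; lra.
have X'0 : 0 <= X' by rewrite /X'; lra.
have [N HN] := count C' C'0.
exists (X' * (b + C') ^+ N + 1).
  by apply: addr_ge0 => //; apply: mulr_ge0 => //; apply: exprn_ge0; lra.
move=> x T xpos x0X step.
have bnd n r : milestones b eps k C' X' n.+1 r -> r n <= X' * (b + C') ^+ N.
  move=> mr; have nN := HN _ _ _ mr.
  have := @milestones_le_geometric _ _ _ _ _ _ _ _ _ C'0 _ X'0 mr n (ltnSn n).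
  move/(_ ltac:(lra) ltac:(lra))/le_trans; apply.
  by apply: ler_wpM2l => //; apply: ler_weXn2l; [lra | exact: ltnW].
have inv t : (t <= T)%N -> exists n r,
    [/\ milestones b eps k C' X' n.+1 r,
        forall i, (i <= n)%N -> datum x t (r i),
        forall s, (s < t)%N -> x s <= r n + 1
      & r n + 1 < x t -> milestones b eps k C' X' n.+2 (extend r n.+1 (x t))].
  elim: t => [|t IH] tT.
    have m0 : milestones b eps k C' X' 1 (fun=> 0) by split.
    exists 0%N, (fun=> 0); split => // [i _|]; first by left.
    by move=> h; apply: milestones_extend => // _; rewrite /X'; lra.
  have [n [r [mr dr old new]]] := IH (ltnW tT).
  have [H1 H2 H3] := step t tT.
  have rgap i : (i < n)%N -> r i + 1 <= r i.+1.
    by move=> h; case: mr => _ gap _ _ _; apply/ltW/gap.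
  have [xs|xl] := lerP (x t) (r n + 1).
    exists n, r; split => //.
    - by move=> i /dr; exact: datumS.
    - by move=> s; rewrite ltnS leq_eqVlt => /orP[/eqP ->//|]; exact: old.
    - have bx : b * x t <= b * (r n + 1) by rewrite ler_wpM2l //; lra.
      move=> h; apply: milestones_extend => //.
      + move=> n0; move: bx; rewrite n0; case: mr => -> _ _ _ _; rewrite /X'; lra.
      + by move=> _; rewrite /C'; lra.
      + move=> i ni; rewrite ni in rgap dr H3 xs *.
        have g0 := rgap i (ltnW (ltnSn _)).
        have := H3 (r i.+1) (r i.+2) (dr _ (ltnW (ltnSn _))) (dr _ (leqnn _))
           (rgap _ (ltnSn _)) xs.
        have : 0 <= (b - eps) * (r i.+1 - r i) by apply: mulr_ge0; lra.
        by rewrite /C'; lra.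
  have mr' := new xl.
  exists n.+1, (extend r n.+1 (x t)); split => //.
  - move=> i; rewrite leq_eqVlt => /orP[/eqP ->|h].
      by rewrite extend_last; right; exists t.
    by rewrite extend_below //; apply/datumS/dr.
  - move=> s; rewrite extend_last ltnS leq_eqVlt => /orP[/eqP ->|/old]; lra.
  - move=> h; apply: milestones_extend => //.
    + by move=> _; rewrite extend_last /C'; lra.
    + move=> i [ni]; subst n; rewrite extend_last !extend_below //.
      have rx : r i.+1 <= x t by move: xl; clear; lra.
      have := H2 _ _ (dr i (leqnSn _)) (dr i.+1 (leqnn _)) (rgap i (ltnSn _)) rx.
      by rewrite /C'; move: b1; clear; lra.
move=> t tT; have [n [r [mr _ _ new]]] := inv t tT.
have [xs|xl] := lerP (x t) (r n + 1).
  by have := bnd _ _ mr; lra.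
by have := bnd _ _ (new xl); rewrite extend_last; lra.
Qed.

(** * Discrepancy of two power laws *)

(** Concavity of s |-> 1 - exp (- s), which vanishes at 0, would give the factor
    max (1, u / v); the sum 1 + u / v is enough here.  The bound is uniform in
    be, which is what makes the extrapolation estimate uniform in the difference
    of the two exponents. *)
Lemma one_sub_expRN_ratio (R : realType) (be u v : R) :
  0 <= be -> 0 <= u -> 0 < v ->
  (1 - expR (- (be * u))) * v <= (u + v) * (1 - expR (- (be * v))).
Proof.
move=> be0 u0 v0.
set T := expR (- (be * v)).
have T0 : 0 < T by exact: expR_gt0.
have T1 : T <= 1 by rewrite /T expR_le1 oppr_le0 mulr_ge0 // ltW.
have tang : T * (be * v) <= 1 - T.
  have := ler_wpM2r (ltW T0) (expR_ge1Dx (be * v)).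
  by rewrite expRxMexpNx_1 mulrDl mul1r mulrC; clear; lra.
have [uv|vu] := lerP u v.
  have h : 1 - expR (- (be * u)) <= 1 - T.
    by rewrite lerB // ler_expR lerN2 ler_wpM2l.
  apply: (@le_trans _ _ ((1 - T) * v)); first by apply: ler_wpM2r => //; exact: ltW.
  by rewrite mulrC ler_wpM2r ?subr_ge0 // lerDr.
have h : T * (1 - be * (u - v)) <= expR (- (be * u)).
  have -> : - (be * u) = - (be * v) + - (be * (u - v)) by ring.
  rewrite expRD; apply: ler_wpM2l; first exact: ltW.
  exact: expR_ge1Dx.
apply: (@le_trans _ _ ((1 - T * (1 - be * (u - v))) * v)).
  by apply: ler_wpM2r; [exact: ltW | rewrite lerD2l lerN2].
have k : T * (be * v) * (u - v) <= (1 - T) * (u - v).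
  by apply: ler_wpM2r => //; rewrite subr_ge0 ltW.
have k2 : 0 <= v * (1 - T) by rewrite mulr_ge0 ?subr_ge0 // ltW.
have -> : (1 - T * (1 - be * (u - v))) * v = v * (1 - T) + T * (be * v) * (u - v).
  by ring.
have -> : (u + v) * (1 - T) = v * (1 - T) + (1 - T) * (u - v) + v * (1 - T) by ring.
by move: k k2; clear; lra.
Qed.

(** On the logarithmic scale, the difference between the responses of the
    parameters (P, c) and (- Q, b). *)
Definition expsum (R : realType) (P Q c b x : R) : R :=
  P * expR (c * x) + Q * expR (b * x).

(** Dividing by the slower exponential leaves a function that is monotone in x,
    whatever the signs of P and Q. *)
Lemma norm_expsum (R : realType) (P Q c b x : R) :
  `|expsum P Q c b x| = expR (c * x) * `|P + Q * expR ((b - c) * x)|.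
Proof.
rewrite -[X in X * _]ger0_norm ?expR_ge0 // -normrM; congr `|_|.
rewrite /expsum mulrDr mulrC; congr (_ + _).
by rewrite mulrCA -expRD; congr (_ * expR _); ring.
Qed.

Lemma norm_factor_le (R : realType) (P Q c b D x : R) :
  `|expsum P Q c b x| <= D ->
  `|P + Q * expR ((b - c) * x)| <= D * expR (- (c * x)).
Proof.
rewrite norm_expsum => h.
rewrite -(ler_pM2l (expR_gt0 (c * x))) mulrCA expRxMexpNx_1 mulr1.
exact: h.
Qed.

(** Beyond q the discrepancy grows at the faster rate b, but between p and q only
    at the slower rate c.  This asymmetry is the source of the damping when the
    true exponent is the slower one. *)
Lemma expsum_extrapolate (R : realType) (P Q c b D p q x : R) :
  0 <= c <= b -> 0 <= D -> p < q -> q <= x ->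
  `|expsum P Q c b p| <= D -> `|expsum P Q c b q| <= D ->
  `|expsum P Q c b x| * (q - p) <=
    3 * D * (x - p) * expR (c * (q - p) + b * (x - q)).
Proof.
move=> /andP[c0 cb] D0 pq qx /norm_factor_le hp /norm_factor_le hq.
rewrite norm_expsum.
have [be0 beE] : 0 <= b - c /\ b = c + (b - c) by split; [rewrite subr_ge0 | ring].
rewrite [in X in _ <= X]beE.
move: (b - c) be0 hp hq {cb beE} => be be0 hp hq.
set hx := P + Q * expR (be * x); set h_q := P + Q * expR (be * q) in hq *.
set h_p := P + Q * expR (be * p) in hp *.
have v0 : 0 < q - p by rewrite subr_gt0.
have u0 : 0 <= x - q by rewrite subr_ge0.
have key : (expR (be * x) - expR (be * q)) * (q - p) <=
    (x - p) * expR (be * (x - q)) * (expR (be * q) - expR (be * p)).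
  have h := ler_wpM2l (expR_ge0 (be * x)) (one_sub_expRN_ratio be0 u0 v0).
  have e1 : expR (be * x) * expR (- (be * (x - q))) = expR (be * q).
    by rewrite -expRD; congr expR; ring.
  have e2 : expR (be * (x - q)) * expR (be * q) = expR (be * x).
    by rewrite -expRD; congr expR; ring.
  have e3 : expR (be * (x - q)) * expR (be * p) = expR (be * x) * expR (- (be * (q - p))).
    by rewrite -!expRD; congr expR; ring.
  have -> : (expR (be * x) - expR (be * q)) * (q - p) =
      expR (be * x) * ((1 - expR (- (be * (x - q)))) * (q - p)) by rewrite -e1; ring.
  apply: (le_trans h); rewrite le_eqVlt; apply/orP; left; apply/eqP.
  have -> : (x - p) * expR (be * (x - q)) * (expR (be * q) - expR (be * p)) =
      (x - p) * (expR (be * (x - q)) * expR (be * q)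
                 - expR (be * (x - q)) * expR (be * p)) by ring.
  by rewrite e2 e3; ring.
have Qabs : `|hx - h_q| * (q - p) <= (x - p) * expR (be * (x - q)) * `|h_q - h_p|.
  have -> : hx - h_q = Q * (expR (be * x) - expR (be * q)) by rewrite /hx /h_q; ring.
  have -> : h_q - h_p = Q * (expR (be * q) - expR (be * p)) by rewrite /h_p /h_q; ring.
  have mono y z : y <= z -> 0 <= expR (be * z) - expR (be * y).
    by move=> yz; rewrite subr_ge0 ler_expR ler_wpM2l.
  rewrite !normrM (ger0_norm (mono _ _ qx)) (ger0_norm (mono _ _ (ltW pq))).
  have := ler_wpM2l (normr_ge0 Q) key.
  by rewrite !mulrA ![_ * `|Q|]mulrC !mulrA.
have xp : 0 <= x - p by lra.
have Ecq : expR (- (c * q)) <= expR (- (c * p)).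
  by rewrite ler_expR lerN2 ler_wpM2l // ltW.
have hqp : `|h_q - h_p| <= 2 * (D * expR (- (c * p))).
  apply: (le_trans (ler_normB _ _)).
  have : D * expR (- (c * q)) <= D * expR (- (c * p)) by apply: ler_wpM2l.
  by move: hp hq; clear; lra.
have B1 : 1 <= expR (be * (x - q)).
  by rewrite -[leLHS]expR0 ler_expR mulr_ge0.
have tri : `|hx| * (q - p) <= 3 * (D * expR (- (c * p))) * ((x - p) * expR (be * (x - q))).
  have -> : hx = h_q + (hx - h_q) by ring.
  apply: (le_trans (ler_wpM2r (ltW v0) (ler_normD _ _))).
  rewrite mulrDl.
  have t1 : `|h_q| * (q - p) <= D * expR (- (c * p)) * ((x - p) * expR (be * (x - q))).
    apply: ler_pM => //; first exact: ltW.
      by apply: (le_trans hq); apply: ler_wpM2l.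
    rewrite -[leLHS]mulr1; apply: ler_pM => //; first exact: ltW.
    by move: qx; clear; lra.
  have t2 := le_trans Qabs (ler_wpM2l (mulr_ge0 xp (expR_ge0 _)) hqp).
  move: t1 t2; set z := (x - p) * _; clear; lra.
rewrite -[leLHS]mulrA; apply: (le_trans (ler_wpM2l (expR_ge0 _) tri)).
rewrite le_eqVlt; apply/orP; left; apply/eqP.
have -> : c * (q - p) + (c + be) * (x - q) = c * x + - (c * p) + be * (x - q) by ring.
by rewrite !expRD; ring.
Qed.

(** The absolute value of the monotone factor of [norm_expsum] is largest at an
    endpoint. *)
Lemma expsum_interpolate (R : realType) (P Q c b D p q x : R) :
  0 <= c <= b -> 0 <= D -> p <= x <= q ->
  `|expsum P Q c b p| <= D -> `|expsum P Q c b q| <= D ->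
  `|expsum P Q c b x| <= D * expR (c * (x - p)).
Proof.
move=> /andP[c0 cb] D0 /andP[px xq] /norm_factor_le hp /norm_factor_le hq.
have cx : expR (c * (x - p)) = expR (c * x) * expR (- (c * p)).
  by rewrite -expRD; congr expR; ring.
rewrite norm_expsum cx mulrCA; apply: ler_wpM2l; first exact: expR_ge0.
have {}hq : `|P + Q * expR ((b - c) * q)| <= D * expR (- (c * p)).
  apply: (le_trans hq); apply: ler_wpM2l => //; rewrite ler_expR lerN2 ler_wpM2l //.
  exact: le_trans xq.
have be0 : 0 <= b - c by rewrite subr_ge0.
have m1 : expR ((b - c) * p) <= expR ((b - c) * x) by rewrite ler_expR ler_wpM2l.
have m2 : expR ((b - c) * x) <= expR ((b - c) * q) by rewrite ler_expR ler_wpM2l.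
move: hp hq; rewrite !ler_norml => /andP[p1 p2] /andP[q1 q2].
have [Q0|Q0] := lerP 0 Q.
  have := ler_wpM2l Q0 m1; have := ler_wpM2l Q0 m2.
  by move: p1 p2 q1 q2; clear; lra.
have := ler_wnM2l (ltW Q0) m1; have := ler_wnM2l (ltW Q0) m2.
by move: p1 p2 q1 q2; clear; lra.
Qed.

(** Two readings fix the slope of the monotone factor, and by convexity of exp the
    slope is smaller to the left of p than between p and q; the factor
    exp (c x) <= exp (c p) compensates for the rest. *)
Lemma expsum_below (R : realType) (P Q c b D p q x : R) :
  0 <= c <= b -> 0 <= D -> x <= p -> p + 1 <= q ->
  `|expsum P Q c b p| <= D -> `|expsum P Q c b q| <= D ->
  `|expsum P Q c b x| <= D * (1 + 2 * (p - x)).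
Proof.
move=> /andP[c0 cb] D0 xp pq /norm_factor_le hp /norm_factor_le hq.
rewrite norm_expsum.
have be0 : 0 <= b - c by rewrite subr_ge0.
move: (b - c) be0 hp hq {cb} => be be0 hp hq.
have hqp : `|Q * (expR (be * q) - expR (be * p))| <= 2 * (D * expR (- (c * p))).
  have -> : Q * (expR (be * q) - expR (be * p)) =
     (P + Q * expR (be * q)) - (P + Q * expR (be * p)) by ring.
  apply: (le_trans (ler_normB _ _)).
  have pq' : p <= q by move: pq; clear; lra.
  have : D * expR (- (c * q)) <= D * expR (- (c * p)).
    by apply: ler_wpM2l => //; rewrite ler_expR lerN2 ler_wpM2l.
  by move: hp hq; clear; lra.
have tan y : expR (be * p) * (be * (y - p)) <= expR (be * y) - expR (be * p).
  have -> : be * y = be * p + be * (y - p) by ring.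
  rewrite expRD.
  have := ler_wpM2l (expR_ge0 (be * p)) (expR_ge1Dx (be * (y - p))).
  by rewrite mulrDr mulr1; clear; lra.
have px : 0 <= p - x by rewrite subr_ge0.
have key : expR (be * p) - expR (be * x) <=
    (expR (be * q) - expR (be * p)) * (p - x).
  have t1 := tan x; have t2 := ler_wpM2r px (tan q).
  have t3 : 0 <= expR (be * p) * be * (q - p - 1) * (p - x).
    by rewrite !mulr_ge0 ?expR_ge0 //; move: pq; clear; lra.
  by move: t1 t2 t3; clear; lra.
have dx : 0 <= expR (be * p) - expR (be * x).
  by rewrite subr_ge0 ler_expR ler_wpM2l.
have dq : 0 <= expR (be * q) - expR (be * p).
  by rewrite subr_ge0 ler_expR ler_wpM2l //; move: pq; clear; lra.
have hxb : `|P + Q * expR (be * x)| <= D * (1 + 2 * (p - x)) * expR (- (c * p)).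
  have -> : P + Q * expR (be * x) = (P + Q * expR (be * p)) - Q * (expR (be * p) - expR (be * x)).
    by ring.
  apply: (le_trans (ler_normB _ _)).
  have : `|Q * (expR (be * p) - expR (be * x))| <= 2 * (D * expR (- (c * p))) * (p - x).
    rewrite normrM (ger0_norm dx).
    apply: (le_trans (ler_wpM2l (normr_ge0 Q) key)).
    rewrite [leLHS]mulrA; apply: ler_wpM2r => //.
    by rewrite -{1}(ger0_norm dq) -normrM.
  by move: hp; clear; lra.
apply: (le_trans (ler_wpM2l (expR_ge0 _) hxb)).
rewrite mulrCA -expRD ler_piMr //.
  by rewrite mulr_ge0 // addr_ge0 // mulr_ge0.
by rewrite expR_le1 subr_le0 ler_wpM2l.
Qed.

Lemma expsum_near (R : realType) (P Q c b D p q x : R) :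
  0 <= c <= b -> 0 <= D -> 0 <= p -> p + 1 <= q -> 0 <= x <= q + 1 ->
  `|expsum P Q c b p| <= D -> `|expsum P Q c b q| <= D ->
  `|expsum P Q c b x| <= 6 * D * (1 + q) * (expR b * expR (b * (q - p))).
Proof.
move=> cb D0 p0 pq /andP[x0 xq] hp hq.
have /andP[c0 cleb] := cb.
have b0 : 0 <= b := le_trans c0 cleb.
have q0 : 0 <= q by move: p0 pq; clear; lra.
have Eb : 1 <= expR b by rewrite -[leLHS]expR0 ler_expR.
have Eq : 1 <= expR (b * (q - p)).
  by rewrite -[leLHS]expR0 ler_expR mulr_ge0 //; move: pq; clear; lra.
have Eqb : expR (b * (q - p)) <= expR b * expR (b * (q - p)).
  by apply: ler_peMl => //; exact: expR_ge0.
have F1 : 1 <= expR b * expR (b * (q - p)) := le_trans Eq Eqb.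
have Dq : 0 <= D * q by apply: mulr_ge0.
have [xp|px] := lerP x p.
  apply: (le_trans (expsum_below cb D0 xp pq hp hq)).
  rewrite -[leLHS]mulr1; apply: ler_pM => //.
    by rewrite mulr_ge0 // addr_ge0 // mulr_ge0 // subr_ge0.
  have : D * (p - x) <= D * q.
    by apply: ler_wpM2l => //; move: x0 pq; clear; lra.
  by move: D0 Dq; clear; lra.
have [xq'|qx] := lerP x q.
  have pxq : p <= x <= q by rewrite xq' ltW.
  apply: (le_trans (expsum_interpolate cb D0 pxq hp hq)).
  apply: ler_pM; rewrite ?expR_ge0 //.
    by move: D0 Dq; clear; lra.
  apply: le_trans Eqb; rewrite ler_expR.
  by apply: ler_pM => //; move: px xq'; clear; lra.
have pq' : p < q by move: pq; clear; lra.
have := expsum_extrapolate cb D0 pq' (ltW qx) hp hq.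
have -> : 3 * D * (x - p) * expR (c * (q - p) + b * (x - q)) =
   (3 * D * expR (c * (q - p) + b * (x - q))) * (x - p) by ring.
set e := expR (c * _ + _) => h.
have e1 : e <= expR b * expR (b * (q - p)).
  rewrite -expRD ler_expR [leRHS]addrC lerD //.
    by apply: ler_wpM2r => //; move: pq; clear; lra.
  by rewrite -[leRHS]mulr1; apply: ler_wpM2l => //; move: xq; clear; lra.
have e0 : 0 <= D * e by rewrite mulr_ge0 ?expR_ge0.
have v1 : 1 <= q - p by move: pq; clear; lra.
have h2 : `|expsum P Q c b x| * (q - p) <= 6 * (D * e) * (q - p).
  apply: (le_trans h).
  have : 0 <= D * e * (2 * (q - p) - (x - p)).
    by apply: mulr_ge0 => //; move: pq xq; clear; lra.
  by clear; lra.
rewrite ler_pM2r in h2; last by apply: lt_le_trans v1.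
apply: (le_trans h2).
rewrite [leLHS]mulrA; apply: ler_pM; rewrite ?expR_ge0 //; first by rewrite mulr_ge0.
by move: D0 Dq; clear; lra.
Qed.

(** * From the quality of the estimate to slow steps *)

(** Here (a, b) is the true parameter and (a', b') its estimate: their predictions
    agree up to D at all data, and a bound on their discrepancy at the current
    level yields a bound on the next level. *)
Definition uncertain_next (R : realType) (D M k C a a' b b' : R) (x : nat -> R) (t : nat) : Prop :=
  (forall q, datum x t q -> `|expsum a (- a') b b' q| <= D) /\
  (forall v z, 0 <= v -> 0 <= z ->
     `|expsum a (- a') b b' (x t)| <= M * (1 + z) * expR v ->
     x t.+1 <= v + k * z + C).

Lemma expsum_crude (R : realType) (a a' b b' c A x : R) :
  `|a| <= A -> `|a'| <= A -> b <= c -> b' <= c -> 0 <= x ->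
  `|expsum a (- a') b b' x| <= 2 * A * expR (c * x).
Proof.
move=> aA a'A bc b'c x0.
have e y : y <= c -> expR (y * x) <= expR (c * x).
  by move=> yc; rewrite ler_expR ler_wpM2r.
apply: (le_trans (ler_normD _ _)); rewrite !normrM normrN !(ger0_norm (expR_ge0 _)).
have := ler_pM (normr_ge0 _) (expR_ge0 _) aA (e _ bc).
have := ler_pM (normr_ge0 _) (expR_ge0 _) a'A (e _ b'c).
by clear; lra.
Qed.

Lemma datum_ge0 (R : realType) (x : nat -> R) t q :
  (forall s, 0 <= x s) -> datum x t q -> 0 <= q.
Proof. by move=> x0 [->|[s _ ->]]. Qed.

(** The true exponent b is the smaller of the two and governs the range between
    the readings p and q, where it saves eps (q - p). *)
Lemma slow_step_of_gap (R : realType) (c eps D M k C A a a' b b' : R)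
    (x : nat -> R) (t : nat) :
  0 <= k -> 2 * A <= D -> 6 * (D + 1) * expR c <= M ->
  `|a| <= A -> `|a'| <= A -> 0 <= b -> b <= b' -> b' <= c -> b <= c - eps ->
  (forall s, 0 <= x s) ->
  uncertain_next D M k C a a' b b' x t -> slow_step c eps k C x t.
Proof.
move=> k0 AD DM aA a'A b0 bb' b'c bgap xpos [data next].
have b'0 := le_trans b0 bb'; have c0 := le_trans b'0 b'c.
have A0 := le_trans (normr_ge0 a) aA.
have D0 : 0 <= D by move: A0 AD; clear; lra.
have Ec : 1 <= expR c by rewrite -[leLHS]expR0 ler_expR.
have DM6 : 6 * D * expR c <= M.
  by apply: le_trans DM; apply: ler_wpM2r; [exact: expR_ge0 | clear; lra].
have DM1 : 6 * D <= M.
  by apply: le_trans DM6; rewrite ler_peMr // mulr_ge0.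
have bb'01 : 0 <= b <= b' by rewrite b0 bb'.
split.
- have := next (c * x t) 0; rewrite mulr0 !addr0 mulr1; apply => //.
    by rewrite mulr_ge0.
  apply: (le_trans (expsum_crude aA a'A (le_trans bb' b'c) b'c (xpos t))).
  by apply: ler_wpM2r; [exact: expR_ge0 | move: AD D0 DM1; clear; lra].
- move=> p q dp dq pq qx.
  have p0 := datum_ge0 xpos dp.
  have pq' : p < q by move: pq; clear; lra.
  have qp0 : 0 <= q - p by rewrite subr_ge0 ltW.
  have xq0 : 0 <= x t - q by rewrite subr_ge0.
  have xt0 := xpos t.
  have := next (b * (q - p) + b' * (x t - q)) (x t).
  move=> /(_ (addr_ge0 (mulr_ge0 b0 qp0) (mulr_ge0 b'0 xq0)) xt0) N.
  have {}N : x t.+1 <= b * (q - p) + b' * (x t - q) + k * x t + C.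
    apply: N; have := expsum_extrapolate bb'01 D0 pq' qx (data _ dp) (data _ dq).
    set e := expR _ => h.
    have g : `|expsum a (- a') b b' (x t)| <= `|expsum a (- a') b b' (x t)| * (q - p).
      by rewrite ler_peMr //; move: pq; clear; lra.
    apply: (le_trans (le_trans g h)); apply: ler_wpM2r; first exact: expR_ge0.
    apply: ler_pM; rewrite ?mulr_ge0 //.
    + by rewrite subr_ge0; move: pq qx; clear; lra.
    + by move: DM1 D0; clear; lra.
    + by move: p0; clear; lra.
  have t1 : b * (q - p) <= (c - eps) * (q - p) by apply: ler_wpM2r.
  have t2 : b' * (x t - q) <= c * (x t - q) by apply: ler_wpM2r.
  by move: N t1 t2; clear; lra.
- move=> p q dp dq pq xq.
  have p0 := datum_ge0 xpos dp.
  have q0 := datum_ge0 xpos dq.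
  have qp0 : 0 <= q - p by move: pq; clear; lra.
  have xt : 0 <= x t <= q + 1 by rewrite xpos.
  apply: (next (c * (q - p)) q) => //; first by rewrite mulr_ge0.
  apply: (le_trans (expsum_near bb'01 D0 p0 pq xt (data _ dp) (data _ dq))).
  rewrite mulrA; apply: ler_pM; rewrite ?mulr_ge0 ?addr_ge0 ?expR_ge0 //.
    rewrite mulrAC; apply: ler_wpM2r; first by rewrite addr_ge0.
    by apply: le_trans DM6; apply: ler_wpM2l; rewrite ?ler_expR // mulr_ge0.
  by rewrite ler_expR; apply: ler_wpM2r.
Qed.

(** When b' - b is tiny relative to exp (- c B), the ratio of the two power laws
    is constant up to a negligible error on levels below B, so that one reading q
    suffices: the next level is at most c (x t - q) + C.  Since q - p is not
    negative and c >= 1, this is a slow step with damping 1. *)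
Lemma slow_step_of_close (R : realType) (c B D M k C A a a' b b' : R)
    (x : nat -> R) (t : nat) :
  0 <= k -> 1 <= c -> 2 * A <= D -> 6 * (D + 1) * expR c <= M ->
  `|a| <= A -> `|a'| <= A -> 0 <= b -> b <= b' -> b' <= c ->
  A * expR (c * B) * (expR ((b' - b) * B) - 1) <= 1 ->
  (forall s, 0 <= x s) -> (forall s, (s <= t)%N -> x s <= B) ->
  uncertain_next D M k C a a' b b' x t -> slow_step c 1 k C x t.
Proof.
move=> k0 c1 AD DM aA a'A b0 bb' b'c close xpos xB [data next].
have b'0 := le_trans b0 bb'; have c0 := le_trans b'0 b'c.
have bc := le_trans bb' b'c.
have A0 := le_trans (normr_ge0 a) aA.
have D0 : 0 <= D by move: A0 AD; clear; lra.
have Ec : 1 <= expR c by rewrite -[leLHS]expR0 ler_expR.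
have DM6 : (D + 1) * expR c <= M.
  by apply: le_trans DM; apply: ler_wpM2r; [exact: expR_ge0 | move: D0; clear; lra].
have DM1 : D + 1 <= M.
  by apply: le_trans DM6; rewrite ler_peMr // addr_ge0.
have xt0 := xpos t; have xtB := xB t (leqnn t).
have B0 : 0 <= B := le_trans xt0 xtB.
have be0 : 0 <= b' - b by rewrite subr_ge0.
have key q w : datum x t q -> 0 <= w -> x t - q <= w ->
    `|expsum a (- a') b b' (x t)| <= (D + 1) * expR (c * w).
  move=> dq w0 xqw.
  have q0 := datum_ge0 xpos dq.
  have qB : q <= B by case: dq => [->//|[s st ->]]; apply: xB; exact: ltnW.
  have hq := norm_factor_le (data _ dq).
  rewrite norm_expsum.
  have E1 y : 0 <= y -> y <= B -> 1 <= expR ((b' - b) * y) <= expR ((b' - b) * B).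
    by move=> y0 yB; rewrite -[X in X <= _ <= _]expR0 !ler_expR mulr_ge0 ?ler_wpM2l.
  have dE : `|expR ((b' - b) * x t) - expR ((b' - b) * q)| <= expR ((b' - b) * B) - 1.
    have /andP[u1 u2] := E1 _ xt0 xtB; have /andP[v1 v2] := E1 _ q0 qB.
    by rewrite ler_norml; apply/andP; split; move: u1 u2 v1 v2; clear; lra.
  have hx : `|a + - a' * expR ((b' - b) * x t)| <=
      D * expR (- (b * q)) + A * (expR ((b' - b) * B) - 1).
    have -> : a + - a' * expR ((b' - b) * x t) = (a + - a' * expR ((b' - b) * q))
       - a' * (expR ((b' - b) * x t) - expR ((b' - b) * q)) by ring.
    apply: (le_trans (ler_normB _ _)); apply: lerD => //.
    by rewrite normrM; apply: ler_pM.
  apply: (le_trans (ler_wpM2l (expR_ge0 _) hx)).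
  rewrite mulrDr [leRHS]mulrDl mul1r; apply: lerD.
    rewrite mulrCA; apply: ler_wpM2l => //; rewrite -expRD ler_expR.
    have -> : b * x t + - (b * q) = b * (x t - q) by ring.
    apply: (@le_trans _ _ (b * w)); first exact: ler_wpM2l.
    exact: ler_wpM2r.
  apply: (@le_trans _ _ 1); last by rewrite -[leLHS]expR0 ler_expR mulr_ge0.
  apply: le_trans close; rewrite [leLHS]mulrCA mulrA; apply: ler_wpM2r.
    by have /andP[_ v] := E1 _ B0 (lexx B); have /andP[u _] := E1 _ B0 (lexx B); rewrite subr_ge0.
  apply: ler_wpM2l => //; rewrite ler_expR; apply: ler_pM => //.
split.
- have := next (c * x t) 0; rewrite mulr0 !addr0 mulr1; apply => //.
    by rewrite mulr_ge0.
  apply: (le_trans (expsum_crude aA a'A bc b'c xt0)).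
  by apply: ler_wpM2r; [exact: expR_ge0 | move: AD D0 DM1; clear; lra].
- move=> p q dp dq pq qx.
  have xq0 : 0 <= x t - q by rewrite subr_ge0.
  have := next (c * (x t - q)) 0; rewrite mulr0 !addr0 mulr1.
  move=> /(_ (mulr_ge0 c0 xq0) (lexx _)) N.
  have {}N : x t.+1 <= c * (x t - q) + C.
    apply: N; apply: (le_trans (key _ _ dq xq0 (lexx _))).
    by apply: ler_wpM2r => //; exact: expR_ge0.
  have t1 : 0 <= (c - 1) * (q - p).
    by rewrite mulr_ge0 ?subr_ge0 //; move: pq; clear; lra.
  have t2 : 0 <= k * x t by rewrite mulr_ge0.
  by move: N t1 t2; clear; lra.
- move=> p q dp dq pq xq.
  have q0 := datum_ge0 xpos dq.
  have := next 0 0; rewrite mulr0 !addr0 !add0r mulr1 expR0 mulr1 => N.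
  have {}N : x t.+1 <= C.
    apply: N => //; apply: (le_trans (key _ 1 dq ler01 _)); last by rewrite mulr1.
    by move: xq; clear; lra.
  have t1 : 0 <= c * (q - p) by rewrite mulr_ge0 //; move: pq; clear; lra.
  have t2 : 0 <= k * q by rewrite mulr_ge0.
  by move: N t1 t2; clear; lra.
Qed.

(** * The largest consistent exponent *)

Lemma continuous_phi_exponent (R : realType) (y : R) :
  continuous (fun b : R => phi b y).
Proof.
have [->|y0] := eqVneq y 0.
  have -> : (fun b : R => phi b 0) = cst 0.
    by apply/funext => b; rewrite /phi sgr0 mul0r.
  exact: cst_continuous.
have -> : (fun b : R => phi b y) = (fun b => Num.sg y * expR (b * ln `|y|)).
  by apply/funext => b; rewrite /phi /powR normr_eq0 (negPf y0).
move=> b; apply: cvgM; first exact: cvg_cst.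
apply: continuous_cvg; first exact: continuous_expR.
by apply: cvgM; [exact: cvg_id | exact: cvg_cst].
Qed.

Lemma closed_observation (R : realType) (W hy o y : R) :
  closed [set p : R * R | `|o - p.1 * hy * phi p.2 y| <= W].
Proof.
apply: (@closed_comp _ _ (fun p : R * R => `|o - p.1 * hy * phi p.2 y|) [set z | z <= W]).
  move=> p _; apply: cvg_norm; apply: cvgB; first exact: cvg_cst.
  apply: cvgM.
    by apply: cvgM; [exact: cvg_fst | exact: cvg_cst].
  apply: (@continuous_cvg _ _ _ _ _ (fun p : R * R => p.2) (fun b => phi b y)).
    exact: continuous_phi_exponent.
  exact: cvg_snd.
exact: closed_le.
Qed.

Definition largest_exponent (R : realType) (S : set (R * R)) : R * R :=
  xget (0, 0) [set p | S p /\ forall q, S q -> q.2 <= p.2].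

Lemma largest_exponentP (R : realType) (S : set (R * R)) :
  compact S -> S !=set0 ->
  S (largest_exponent S) /\ forall q, S q -> q.2 <= (largest_exponent S).2.
Proof.
move=> cS S0.
have cf : {within S, continuous (fun p : R * R => p.2)}.
  by apply: continuous_subspaceT => p; exact: cvg_snd.
have [c Sc cmax] := compact_EVT_max S0 cS cf.
rewrite /largest_exponent.
case: xgetP => [p _ //|/(_ c) []].
by split; [exact: set_mem | move=> q /mem_set /cmax].
Qed.

Lemma bounded_gains (R : realType) (P : set (R * R)) : compact P -> P !=set0 ->
  exists2 A : R, 0 <= A & forall p, P p -> `|p.1| <= A.
Proof.
move=> cP P0.
have cf : {within P, continuous (fun p : R * R => `|p.1|)}.
  by apply: continuous_subspaceT => p; apply: cvg_norm; exact: cvg_fst.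
have [c Pc cmax] := compact_EVT_max P0 cP cf.
by exists `|c.1| => // q /mem_set /cmax.
Qed.

Definition cancel_input (R : realType) (h : R -> R) (p : R * R) (y : R) : R :=
  - (p.1 * h y * phi p.2 y).

(** Past inputs are functions of past states, so the set of parameters compatible
    with the observations can be computed from the states alone, together with
    the law itself. *)
Fixpoint consistent (R : realType) (W : R) (h : R -> R) (P : set (R * R))
    (f : nat -> R) (t : nat) : set (R * R) :=
  if t is s.+1 then
    let S := consistent W h P f s in
    S `&` [set p | `|f s.+1 - cancel_input h (largest_exponent S) (f s)
                     - p.1 * h (f s) * phi p.2 (f s)| <= W]
  else P.

(** A finite history is read as a sequence through inord, so that [consistent]
    can be a plain recursion on time; only its first t + 1 values matter
    ([consistent_eq]). *)
Definition largest_exponent_law (R : realType) (W : R) (h : R -> R)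
    (P : set (R * R)) : feedback_law R :=
  fun t g => let f n := g (inord n) in
    cancel_input h (largest_exponent (consistent W h P f t)) (f t).

Lemma consistent_eq (R : realType) (W : R) (h : R -> R) (P : set (R * R))
    (f g : nat -> R) t : (forall i, (i <= t)%N -> f i = g i) ->
  consistent W h P f t = consistent W h P g t.
Proof.
elim: t => [//|t IH] fg /=.
by rewrite IH ?fg // => i it; apply: fg; exact: leqW.
Qed.

Lemma largest_exponent_lawE (R : realType) (W : R) (h : R -> R)
    (P : set (R * R)) (y : nat -> R) t :
  largest_exponent_law W h P (fun i : 'I_t.+1 => y i) =
  cancel_input h (largest_exponent (consistent W h P y t)) (y t).
Proof.
rewrite /largest_exponent_law inordK //; congr (cancel_input _ (largest_exponent _) _).
by apply: consistent_eq => i it; rewrite inordK.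
Qed.

Lemma compact_consistent (R : realType) (W : R) (h : R -> R) (P : set (R * R))
    (f : nat -> R) t : compact P -> compact (consistent W h P f t).
Proof.
move=> cP; elim: t => [//|t IH] /=.
by apply: compact_closedI => //; exact: closed_observation.
Qed.

Lemma consistent_sub (R : realType) (W : R) (h : R -> R) (P : set (R * R))
    (f : nat -> R) t : consistent W h P f t `<=` P.
Proof. by elim: t => [//|t IH] p /= [/IH]. Qed.

Lemma consistent_obs (R : realType) (W : R) (h : R -> R) (P : set (R * R))
    (f : nat -> R) t p : consistent W h P f t p -> forall s, (s < t)%N ->
  `|f s.+1 - cancel_input h (largest_exponent (consistent W h P f s)) (f s)
      - p.1 * h (f s) * phi p.2 (f s)| <= W.
Proof.
elim: t => [//|t IH] [/= cp cW] s; rewrite ltnS leq_eqVlt => /orP[/eqP ->//|].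
exact: IH.
Qed.

Lemma consistent_true (R : realType) (W : R) (h : R -> R) (P : set (R * R))
    p w y t : P p -> admissible_disturbance W w ->
  closed_loop h (largest_exponent_law W h P) p w y -> consistent W h P y t p.
Proof.
move=> Pp aw cl; elim: t => [//|t IH] /=; split => //=.
rewrite cl largest_exponent_lawE.
set u := cancel_input _ _ _; set v := _ * phi _ _.
by rewrite (_ : v + u + w t.+1 - u - v = w t.+1); [exact: aw | ring].
Qed.

(** Truncation at 1 makes levels nonnegative and turns the states with |y| <= 1,
    where a power law is harmless, into the level 0. *)
Definition magnitude (R : realType) (y : R) : R := ln (Num.max 1 `|y|).

Lemma magnitude_ge0 (R : realType) (y : R) : 0 <= magnitude y.
Proof. by rewrite ln_ge0 // le_max lexx. Qed.

Lemma expR_magnitude (R : realType) (y : R) : expR (magnitude y) = Num.max 1 `|y|.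
Proof. by rewrite lnK // posrE lt_max ltr01. Qed.

Lemma norm_phi (R : realType) (b y : R) : 0 < b -> `|phi b y| = `|y| `^ b.
Proof.
move=> b0; rewrite /phi; have [->|y0] := eqVneq y 0.
  by rewrite sgr0 mul0r normr0 powR0 // gt_eqF.
by rewrite normrM normr_sg y0 mul1r ger0_norm // powR_ge0.
Qed.

Lemma prediction_error (R : realType) (A a a' b b' y : R) :
  `|a| <= A -> `|a'| <= A -> 0 < b -> 0 < b' ->
  let err := `|a * phi b y - a' * phi b' y| in
  let E := `|expsum a (- a') b b' (magnitude y)| in
  err = E \/ err <= 2 * A /\ E <= 2 * A.
Proof.
move=> aA a'A b0 b'0 /=.
have [y1|y1] := lerP `|y| 1.
  right; rewrite /magnitude max_l // ln1; split.
    have e (c : R) : 0 < c -> `|phi c y| <= 1.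
      move=> c0; rewrite norm_phi //.
      apply: (@le_trans _ _ (1 `^ c)); last by rewrite powR1.
      by apply: ge0_ler_powR; rewrite ?nnegrE // ltW.
    apply: (le_trans (ler_normB _ _)).
    rewrite (normrM a) (normrM a').
    have := ler_pM (normr_ge0 _) (normr_ge0 _) aA (e _ b0).
    have := ler_pM (normr_ge0 _) (normr_ge0 _) a'A (e _ b'0).
    by clear; lra.
  rewrite /expsum !mulr0 expR0 !mulr1; apply: (le_trans (ler_normB _ _)).
  by move: aA a'A; clear; lra.
left; rewrite /magnitude max_r ?ltW // /expsum.
have y0 : y != 0 by rewrite -normr_gt0; exact: lt_trans y1.
rewrite /phi /powR normr_eq0 (negPf y0).
have -> : a * (Num.sg y * expR (b * ln `|y|)) - a' * (Num.sg y * expR (b' * ln `|y|))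
  = Num.sg y * (a * expR (b * ln `|y|) + - a' * expR (b' * ln `|y|)) by ring.
by rewrite normrM normr_sg y0 mul1r.
Qed.

(** The constant absorbs h, W and the gap between 1 + z and exp (k z). *)
Lemma certainty_next (R : realType) (W : R) (h : R -> R) (hmax A D M k : R)
    (a a' b b' y w' y' : R) :
  0 <= W -> 0 < k -> 0 <= h y -> h y <= hmax ->
  `|a| <= A -> `|a'| <= A -> 0 < b -> 0 < b' -> 2 * A <= D -> D <= M ->
  `|w'| <= W -> y' = a * h y * phi b y + cancel_input h (a', b') y + w' ->
  forall v z, 0 <= v -> 0 <= z ->
    `|expsum a (- a') b b' (magnitude y)| <= M * (1 + z) * expR v ->
    magnitude y' <= v + k * z + (ln (1 + k^-1) + ln (hmax * M + W + 1)).
Proof.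
move=> W0 k0 h0 hM aA a'A b0 b'0 AD DM wW -> v z v0 z0 HE.
have A0 := le_trans (normr_ge0 a) aA.
have M0 : 0 <= M by move: A0 AD DM; clear; lra.
have hmax0 := le_trans h0 hM.
have Ev : 1 <= expR v by rewrite -[leLHS]expR0 ler_expR.
have F1 : 1 <= (1 + z) * expR v.
  by rewrite -[leLHS]mulr1; apply: ler_pM => //; rewrite lerDl.
have err : `|a * phi b y - a' * phi b' y| <= M * ((1 + z) * expR v).
  case: (prediction_error y aA a'A b0 b'0) => [->|[e1 _]]; first by rewrite mulrA.
  apply: (le_trans (le_trans e1 (le_trans AD DM))).
  by rewrite ler_peMr.
have ki : 0 < k^-1 by rewrite invr_gt0.
have G0 : 0 < hmax * M + W + 1.
  by have := mulr_ge0 hmax0 M0; move: W0; clear; lra.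
have zk : 1 + z <= (1 + k^-1) * expR (k * z).
  have e1 : 1 + k * z <= expR (k * z) := expR_ge1Dx _.
  have e2 : (1 + k^-1) * (1 + k * z) <= (1 + k^-1) * expR (k * z).
    by apply: ler_wpM2l => //; rewrite addr_ge0 // ltW.
  apply: le_trans e2.
  have -> : (1 + k^-1) * (1 + k * z) = 1 + z + (k^-1 + k * z).
    by field; exact: lt0r_neq0.
  by rewrite lerDl addr_ge0 // ?mulr_ge0 // ltW.
have ny : Num.max 1 `|a * h y * phi b y + cancel_input h (a', b') y + w'| <=
    (hmax * M + W + 1) * ((1 + z) * expR v).
  rewrite ge_max; apply/andP; split.
    rewrite -[leLHS]mulr1; apply: ler_pM => //.
    by have := mulr_ge0 hmax0 M0; move: W0; clear; lra.
  apply: (le_trans (ler_normD _ _)).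
  have -> : a * h y * phi b y + cancel_input h (a', b') y =
      h y * (a * phi b y - a' * phi b' y) by rewrite /cancel_input /=; ring.
  rewrite normrM (ger0_norm h0).
  have t1 := ler_pM h0 (normr_ge0 _) hM err.
  have t2 : W <= W * ((1 + z) * expR v) by rewrite ler_peMr.
  by move: t1 t2 wW F1; move: ((1 + z) * expR v) => F; clear; lra.
have pos : 0 < Num.max 1 `|a * h y * phi b y + cancel_input h (a', b') y + w'|.
  by rewrite lt_max ltr01.
rewrite -ler_expR expR_magnitude; apply: (le_trans ny).
have -> : v + k * z + (ln (1 + k^-1) + ln (hmax * M + W + 1)) =
   ln (hmax * M + W + 1) + (ln (1 + k^-1) + k * z + v) by ring.
rewrite [leRHS]expRD lnK ?posrE //; apply: ler_wpM2l; first exact: ltW.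
rewrite expRD; apply: ler_wpM2r; first exact: expR_ge0.
rewrite expRD lnK // posrE.
by rewrite addr_gt0.
Qed.

(** Both the true parameter and the estimate explain every past transition with a
    disturbance of size W, so their predictions there differ by at most 2 W. *)
Lemma uncertain_next_run (R : realType) (W : R) (h : R -> R) (hmin hmax A D M k : R)
    (P : set (R * R)) (p : R * R) (w y : nat -> R) (t : nat) :
  0 <= W -> 0 < k -> 0 < hmin -> (forall z, hmin <= h z <= hmax) ->
  (forall q, P q -> `|q.1| <= A) -> (forall q, P q -> 0 < q.2) -> compact P ->
  2 * W / hmin + 2 * A <= D -> D <= M ->
  P p -> admissible_disturbance W w ->
  closed_loop h (largest_exponent_law W h P) p w y ->
  let q := largest_exponent (consistent W h P y t) in
  [/\ P q, p.2 <= q.2 &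
    uncertain_next D M k (ln (1 + k^-1) + ln (hmax * M + W + 1))
      p.1 q.1 p.2 q.2 (fun s => magnitude (y s)) t].
Proof.
move=> W0 k0 hmin0 hb PA Pb cP DE DM Pp aw cl q.
have cp s : consistent W h P y s p := consistent_true s Pp aw cl.
have [Sq qmax] : consistent W h P y t q /\
    forall r, consistent W h P y t r -> r.2 <= q.2.
  by apply: largest_exponentP; [exact: compact_consistent | exists p].
have Pq : P q := consistent_sub Sq.
have Wh : 0 <= 2 * W / hmin by rewrite divr_ge0 ?mulr_ge0 // ltW.
have A0 : 0 <= A := le_trans (normr_ge0 _) (PA p Pp).
have AD : 2 * A <= D by move: DE Wh; clear; lra.
split => //; first exact: qmax.
split.
- move=> _ [->|[s st ->]].
    rewrite /expsum !mulr0 expR0 !mulr1; apply: (le_trans (ler_normB _ _)).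
    by have := PA _ Pp; have := PA _ Pq; move: AD; clear; lra.
  case: (prediction_error (y s) (PA _ Pp) (PA _ Pq) (Pb _ Pp) (Pb _ Pq)) => [<-|[_ e]];
    last exact: le_trans AD.
  have o1 := consistent_obs (cp t) st.
  have o2 := consistent_obs Sq st.
  have /andP[hm _] := hb (y s).
  have hs0 : 0 <= h (y s) := le_trans (ltW hmin0) hm.
  have : `|p.1 * phi p.2 (y s) - q.1 * phi q.2 (y s)| <= 2 * W / hmin.
    rewrite ler_pdivlMr // mulrC; apply: (le_trans (ler_wpM2r (normr_ge0 _) hm)).
    rewrite -{1}(ger0_norm hs0) -normrM.
    move: o1 o2; set o := _ - cancel_input _ _ _ => o1 o2.
    have -> : h (y s) * (p.1 * phi p.2 (y s) - q.1 * phi q.2 (y s)) =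
      (o - q.1 * h (y s) * phi q.2 (y s)) - (o - p.1 * h (y s) * phi p.2 (y s)) by ring.
    apply: (le_trans (ler_normB _ _)).
    by move: o1 o2; clear; lra.
  by move: DE A0; clear; lra.
- have /andP[hm hM] := hb (y t).
  have hs0 : 0 <= h (y t) := le_trans (ltW hmin0) hm.
  apply: (certainty_next W0 k0 hs0 hM (PA _ Pp) (PA _ Pq)
    (Pb _ Pp) (Pb _ Pq) AD DM (aw t.+1 isT)).
  by rewrite cl largest_exponent_lawE -surjective_pairing.
Qed.

(** The bound B1 for almost exact exponents is obtained first; it determines how
    close to the critical value, eps, an exponent must be for the estimate to be
    almost exact below B1.  All other parameters have a gap eps. *)
Lemma largest_exponent_law_bounds (R : realType) (W : R) (h : R -> R) (hmin hmax : R)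
    (P : set (R * R)) :
  0 <= W -> 0 < hmin -> (forall z, hmin <= h z <= hmax) ->
  P !=set0 -> compact P -> P `<=` param_space (R := R) ->
  (forall p, P p -> p.2 <= 3 * Num.sqrt 3 / 2) ->
  forall Y : R, 0 <= Y -> exists B : R, forall y,
    trajectories W h (largest_exponent_law W h P) P Y y -> forall t, `|y t| <= B.
Proof.
move=> W0 hmin0 hb P0 cP Pb Pc Y Y0.
have [A A0 PA] := bounded_gains cP P0.
have /andP[sl su] := sqrt3_bounds R.
move: Pc (@bounded_of_slow_steps R); set c := 3 * Num.sqrt 3 / 2 => Pc slow.
have c1 : 1 <= c by rewrite /c; lra.
clearbody c; have c0 : 0 <= c := le_trans ler01 c1.
have hmax0 : 0 <= hmax.
  by have /andP[u v] := hb 0; exact: le_trans (ltW hmin0) (le_trans u v).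
pose D := 2 * W / hmin + 2 * A; pose M := 6 * (D + 1) * expR c.
have D0 : 0 <= D by rewrite addr_ge0 ?mulr_ge0 // invr_ge0 ltW.
have AD : 2 * A <= D by rewrite lerDr divr_ge0 ?mulr_ge0 // ltW.
have DM : D <= M.
  have : D + 1 <= M.
    have D10 : 0 <= D + 1 by rewrite ler_wpDr.
    rewrite /M mulrAC; apply: ler_peMl => //.
    have : 1 <= expR c by rewrite -[leLHS]expR0 ler_expR.
    by clear; lra.
  by clear; lra.
have M0 := le_trans D0 DM.
pose C k := ln (1 + k^-1) + ln (hmax * M + W + 1) : R.
have C0 k : 0 < k -> 0 <= C k.
  move=> k0; rewrite /C addr_ge0 // ln_ge0 // ?lerDl ?invr_ge0 ?(ltW k0) //.
  by rewrite lerDr addr_ge0 // mulr_ge0.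
pose X := magnitude Y.
have X0 : 0 <= X := magnitude_ge0 Y.
have [k1 k10 /(_ _ X (C0 _ k10) X0) [B1 B10 HB1]] := slow 1 ltac:(lra).
(* With b' - b <= eps, exp ((b' - b) B1) <= 1 + m, which makes the error term
   A exp (c B1) (exp ((b' - b) B1) - 1) of the closeness condition at most 1. *)
pose m : R := (A * expR (c * B1) + 1)^-1.
have m0 : 0 < m by rewrite invr_gt0 ltr_wpDl // mulr_ge0 // expR_ge0.
pose eps : R := Num.min 1 (ln (1 + m) / (B1 + 1)).
have eps01 : 0 < eps <= 1.
  rewrite /eps ge_min lexx lt_min ltr01 /=; rewrite andbT.
  by rewrite divr_gt0 // ?ln_gt0 ?ltrDl // ltr_wpDl.
have [k2 k20 /(_ _ X (C0 _ k20) X0) [B2 B20 HB2]] := slow eps eps01.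
exists (expR (Num.max B1 B2)) => y [yY [p [w [Pp aw cl]]]] t.
suff H : magnitude (y t) <= Num.max B1 B2.
  apply: (@le_trans _ _ (expR (magnitude (y t)))); last by rewrite ler_expR.
  by rewrite expR_magnitude le_max lexx orbT.
pose x s := magnitude (y s).
have xpos s : 0 <= x s := magnitude_ge0 (y s).
have xX : x 0%N <= X.
  rewrite -ler_expR !expR_magnitude ge_max le_max lexx /=.
  by rewrite le_max (ger0_norm Y0) yY orbT.
have run k s (k0 : 0 < k) := uncertain_next_run s W0 k0 hmin0 hb PA
  (fun q Pq => Pb q Pq) cP (lexx _) DM Pp aw cl.
have [gap|close] := lerP p.2 (c - eps).
  rewrite le_max; apply/orP; right.
  apply: (HB2 x t xpos xX _ t (leqnn t)) => s _.
  have [Pq pq un] := run k2 s k20.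
  exact: (slow_step_of_gap (ltW k20) AD (lexx _) (PA _ Pp) (PA _ Pq)
    (ltW (Pb _ Pp)) pq (Pc _ Pq) gap xpos un).
rewrite le_max; apply/orP; left.
(* Bootstrap: the estimate is good as long as levels stay below B1, and good
   estimates keep the next level below B1. *)
suff Hall T : forall s, (s <= T)%N -> x s <= B1 by apply: (Hall t t (leqnn t)).
elim: T => [|T IH].
  by apply: (HB1 x 0%N xpos xX).
have IHs : forall s, (s < T.+1)%N -> x s <= B1 by move=> s; exact: IH.
apply: (HB1 x T.+1 xpos xX) => s sT.
have [Pq pq un] := run k1 s k10.
apply: (slow_step_of_close (B := B1) (ltW k10) c1 AD (lexx _) (PA _ Pp) (PA _ Pq)
    (ltW (Pb _ Pp)) pq (Pc _ Pq) _ xpos _ un); last first.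
  by move=> r rs; apply: IHs; exact: leq_ltn_trans sT.
set b' := (largest_exponent _).2 in pq *.
have b'c : b' <= c := Pc _ Pq.
have be : b' - p.2 <= eps by move: b'c close; clear; lra.
have ebm : expR ((b' - p.2) * B1) <= 1 + m.
  rewrite -[leRHS]lnK ?posrE ?addr_gt0 // ler_expR.
  have lm0 : 0 <= ln (1 + m) by rewrite ln_ge0 // lerDl ltW.
  have B11 : 0 < B1 + 1 by rewrite ltr_wpDl.
  apply: (@le_trans _ _ (ln (1 + m) / (B1 + 1) * (B1 + 1))); last first.
    by rewrite divfK // gt_eqF.
  apply: ler_pM; rewrite ?subr_ge0 ?lerDl //.
  by apply: (le_trans be); rewrite /eps ge_min lexx orbT.
have AE0 : 0 <= A * expR (c * B1) by rewrite mulr_ge0 // expR_ge0.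
apply: (@le_trans _ _ (A * expR (c * B1) * m)).
  by apply: ler_wpM2l => //; move: ebm; clear; lra.
rewrite /m ler_pdivrMr ?mul1r ?lerDl //.
by rewrite ltr_wpDl.
Qed.

Lemma sup_abs_le (R : realType) (y : nat -> R) (B : R) :
  (forall t, `|y t| <= B) -> (sup_abs y <= B%:E)%E.
Proof. by move=> yB; apply: ge_ereal_sup => _ [t _ <-]; rewrite lee_fin. Qed.

(** * The adversary *)

(** The current parameter is (g exp (- loss), expo).  The fields pivot, slack and
    next_slack hold the level x_(t-1) and the errors tolerated on the log-gain at
    the levels x_(t-2) and x_(t-1). *)
Record adversary_state (R : realType) := AdversaryState {
  past : nat -> R;
  loss : R;
  expo : R;
  pivot : R;
  slack : R;
  next_slack : R }.

Definition response (R : realType) (h : R -> R) (g d b y : R) : R :=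
  g * expR (- d) * h y * phi b y.

(** Adding slack / 2 to the loss and slack / (2 pivot) to the exponent rotates the
    line x |-> expo x - loss about the pivot, hence preserves the most recent
    observation and changes the one before by at most half of its tolerance.  The
    option that makes the next state larger is taken. *)
Definition adversary_step (R : realType) (h : R -> R) (mu : feedback_law R)
    (g kap : R) (t : nat) (s : adversary_state R) : adversary_state R :=
  let y := past s t in
  let u := mu t (fun i : 'I_t.+1 => past s i) in
  let d := loss s + slack s / 2 in
  let b := expo s + slack s / 2 / pivot s in
  let tilt := `|response h g (loss s) (expo s) y + u| <= `|response h g d b y + u| in
  let d' := if tilt then d else loss s in
  let b' := if tilt then b else expo s in
  AdversaryState
    (fun i => if i == t.+1 then response h g d' b' y + u else past s i)
    d' b' (ln `|y|) (next_slack s) (kap * expR (d' - b' * ln `|y|)).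

Fixpoint adversary (R : realType) (h : R -> R) (mu : feedback_law R)
    (g kap b0 rho y0 : R) (t : nat) : adversary_state R :=
  if t is s.+1 then
    adversary_step h mu g kap s (adversary h mu g kap b0 rho y0 s)
  else AdversaryState (fun=> y0) 0 b0 (ln y0 / 2) rho (rho / 2).

Lemma adversary_past (R : realType) (h : R -> R) (mu : feedback_law R)
    (g kap b0 rho y0 : R) (t i : nat) : (i <= t)%N ->
  past (adversary h mu g kap b0 rho y0 t) i = past (adversary h mu g kap b0 rho y0 i) i.
Proof.
elim: t => [|t IH]; first by case: i.
rewrite leq_eqVlt => /orP[/eqP ->//|it].
by rewrite [LHS]/= ltn_eqF // IH.
Qed.

(** Two fictitious levels precede the actual ones, with a ratio of 2 > sqrt 3, so
    that the first steps are no exception to the general one. *)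
Definition log_levels (R : realType) (y : nat -> R) (n : nat) : R :=
  match n with
  | 0 => ln (y 0%N) / 4
  | 1 => ln (y 0%N) / 2
  | t.+2 => ln `|y t|
  end.

(** The two initial slacks correspond to the fictitious levels and bound the total
    drift of the parameter by rho. *)
Definition slacks (R : realType) (kap rho : R) (D B y : nat -> R) (n : nat) : R :=
  match n with
  | 0 => rho
  | 1 => rho / 2
  | t.+2 => kap * expR (D t.+1 - B t.+1 * ln `|y t|)
  end.

(** The sequences produced by [adversary], in a form that no longer refers to its
    states. *)
Definition adversarial (R : realType) (h : R -> R) (mu : feedback_law R)
    (g kap b0 rho y0 : R) (D B y : nat -> R) : Prop :=
  [/\ y 0%N = y0, D 0%N = 0, B 0%N = b0 &
    forall t,
      let e := slacks kap rho D B y t / 2 in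
      let x := log_levels y t.+1 in
      let u := mu t (fun i : 'I_t.+1 => y i) in
      [/\ y t.+1 = response h g (D t.+1) (B t.+1) (y t) + u,
          (D t.+1 = D t /\ B t.+1 = B t) \/
          (D t.+1 = D t + e /\ B t.+1 = B t + e / x),
          `|response h g (D t) (B t) (y t) + u| <= `|y t.+1| &
          `|response h g (D t + e) (B t + e / x) (y t) + u| <= `|y t.+1|]].

Lemma adversarial_exists (R : realType) (h : R -> R) (mu : feedback_law R)
    (g kap b0 rho y0 : R) :
  exists D B y, adversarial h mu g kap b0 rho y0 D B y.
Proof.
pose s := adversary h mu g kap b0 rho y0.
pose y t := past (s t) t; pose D t := loss (s t); pose B t := expo (s t).
exists D, B, y; split => // t.
have slackE n : slack (s n) = slacks kap rho D B y n /\
    next_slack (s n) = slacks kap rho D B y n.+1.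
  elim: n => [//|n [IH1 IH2]]; split; first exact: IH2.
  by rewrite /s /=.
have pivotE n : pivot (s n) = log_levels y n.+1 by case: n.
have uE : mu t (fun i : 'I_t.+1 => y i) = mu t (fun i : 'I_t.+1 => past (s t) i).
  by congr (mu t _); apply/funext => i; rewrite /y /s adversary_past // -ltnS.
rewrite uE -(slackE t).1 -pivotE /=.
have yE : y t.+1 = past (s t.+1) t.+1 by [].
have DE : D t.+1 = loss (s t.+1) by [].
have BE : B t.+1 = expo (s t.+1) by [].
rewrite yE DE BE.
have -> : s t.+1 = adversary_step h mu g kap t (s t) by [].
rewrite /adversary_step /= eqxx -/(y t) -/(D t) -/(B t).
case: ifP => [tilt|/negbT tilt]; split => //.
- by right.
- by left.
- by rewrite ltW // ltNge.
Qed.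

Lemma responseE (R : realType) (h : R -> R) (g d b y : R) : y != 0 ->
  response h g d b y = g * h y * Num.sg y * expR (b * ln `|y| - d).
Proof.
by move=> y0; rewrite /response /phi /powR normr_eq0 (negPf y0) expRD; ring.
Qed.

(** Two predictions at distance 2 m cannot both be cancelled to less than m by the
    same input u. *)
Lemma forced_response (R : realType) (h : R -> R) (g d b d' b' y u hmin del m : R) :
  y != 0 -> 0 <= hmin -> hmin <= h y -> 0 <= del ->
  b * ln `|y| - d + del <= b' * ln `|y| - d' ->
  `|response h g d b y + u| <= m -> `|response h g d' b' y + u| <= m ->
  `|g| * hmin * expR (b * ln `|y| - d) * del / 2 <= m.
Proof.
move=> y0 hm0 hm del0 gap m1 m2.
have diff : `|response h g d' b' y - response h g d b y| <= 2 * m.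
  have -> : response h g d' b' y - response h g d b y =
    (response h g d' b' y + u) - (response h g d b y + u) by ring.
  by apply: (le_trans (ler_normB _ _)); move: m1 m2; clear; lra.
rewrite ler_pdivrMr // [leRHS]mulrC; apply: le_trans diff.
rewrite !responseE // -mulrBr !normrM normr_sg y0 mulr1.
rewrite [`|h y|]ger0_norm ?(le_trans hm0) // -[leLHS]mulrA.
apply: ler_pM; rewrite ?mulr_ge0 ?expR_ge0 //.
  by apply: ler_wpM2l.
apply: le_trans (ler_norm _).
have t1 : expR (b * ln `|y| - d) * (1 + del) <= expR (b' * ln `|y| - d').
  apply: (@le_trans _ _ (expR (b * ln `|y| - d + del))); last by rewrite ler_expR.
  by rewrite [leRHS]expRD; apply: ler_wpM2l; [exact: expR_ge0 | exact: expR_ge1Dx].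
by move: t1; rewrite mulrDr mulr1; clear; lra.
Qed.

(** The ratio sqrt 3 reproduces itself: x1 <= x3 / 3, and b0 (1 - 1/3) > sqrt 3
    is equivalent to b0 > 3 sqrt 3 / 2. *)
Lemma level_growth (R : realType) (b0 B C x1 x2 x3 x4 : R) :
  3 * Num.sqrt 3 / 2 < b0 -> b0 <= B -> 0 <= x1 ->
  Num.sqrt 3 * x1 <= x2 -> Num.sqrt 3 * x2 <= x3 ->
  C <= (2 * b0 / 3 - Num.sqrt 3) * x3 -> B * (x3 - x1) - C <= x4 ->
  Num.sqrt 3 * x3 <= x4.
Proof.
move=> bc bB x10 h1 h2 hC h3.
have s0 := sqrt3_gt0 R; have ss := sqrt3_sqr R.
have h4 : 3 * x1 <= x3.
  rewrite -ss -mulrA; apply: le_trans h2; apply: ler_wpM2l => //; exact: ltW.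
have h5 : b0 * (x3 - x1) <= B * (x3 - x1).
  by apply: ler_wpM2r => //; move: h4 x10; clear; lra.
have b00 : 0 <= b0 by move: bc s0; clear; lra.
have h6 : b0 * (2 * x3 / 3) <= b0 * (x3 - x1).
  by apply: ler_wpM2l => //; move: h4; clear; lra.
by move: hC h3 h5 h6; clear; lra.
Qed.

(** The slacks are at least kap' exp (- (log-gain)) at their levels, with respect
    to the current parameter; each is at most half the previous one, which makes
    the drift of loss and exponent summable. *)
Definition adversary_invariant (R : realType) (kap kap' b0 rho x0 : R)
    (D B y : nat -> R) (t : nat) : Prop :=
  let x := log_levels y in let e := slacks kap rho D B y in
  [/\ [/\ x0 / 4 <= x t, Num.sqrt 3 * x t <= x t.+1, Num.sqrt 3 * x t.+1 <= x t.+2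
        & x0 <= x t.+2],
      [/\ 0 < e t.+1, e t.+1 <= e t / 2, kap' * expR (D t - B t * x t) <= e t
        & kap' * expR (D t - B t * x t.+1) <= e t.+1],
      0 <= D t <= rho - e t & b0 <= B t <= b0 + rho - e t].

Lemma adversarial_tilt (R : realType) (h : R -> R) (mu : feedback_law R)
    (g kap b0 rho y0 : R) (D B y : nat -> R) (t : nat) :
  adversarial h mu g kap b0 rho y0 D B y ->
  0 < slacks kap rho D B y t -> 1 <= log_levels y t.+1 ->
  exists sig, [/\ 0 <= sig <= slacks kap rho D B y t / 2, D t.+1 = D t + sig,
     B t.+1 = B t + sig / log_levels y t.+1, 0 <= sig / log_levels y t.+1 <= sig &
     forall z, B t.+1 * z - D t.+1 =
       B t * z - D t + sig / log_levels y t.+1 * (z - log_levels y t.+1)].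
Proof.
move=> [_ _ _ /(_ t)]; rewrite /=; set e := slacks _ _ _ _ _ t / 2.
set x := (match t with 0 => _ | _.+1 => _ end) => -[_ DB _ _] e0 x1.
have x0 : 0 < x := lt_le_trans ltr01 x1.
have e20 : 0 <= e by rewrite divr_ge0 // ltW.
have xx s : s / x * x = s by rewrite divfK // gt_eqF.
case: DB => -[DE BE].
  exists 0; rewrite mul0r !addr0 !lexx e20; split => // z.
  by rewrite DE BE; ring.
exists e; split => //.
- by rewrite e20 lexx.
- rewrite divr_ge0 ?(ltW x0) //= ler_pdivrMr // ler_peMr //.
- move=> z; rewrite DE BE mulrBr xx; ring.
Qed.

(** With sig = slack / 2 the rotation separates the predictions at level x_(t+2)
    by a factor exp (slack / 4) at least, because that level exceeds the pivot by
    half of it; and slack >= kap' exp (D - B x_t), so the predictions differ by at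
    least a multiple of exp (B (x_(t+2) - x_t)).  The first levels are taken so
    large that the constants are dominated. *)
Lemma adversary_invariantP (R : realType) (h : R -> R) (mu : feedback_law R)
    (hmin g kap kap' b0 rho y0 : R) (D B y : nat -> R) :
  0 < hmin -> (forall z, hmin <= h z) -> g != 0 -> 3 * Num.sqrt 3 / 2 < b0 ->
  0 < rho -> 0 < kap' -> kap' <= kap -> kap' <= rho / 2 ->
  0 < y0 -> 4 <= ln y0 -> kap * expR (rho - b0 * ln y0) <= rho / 4 ->
  - ln (`|g| * hmin * kap' / 8) <= (2 * b0 / 3 - Num.sqrt 3) * ln y0 ->
  adversarial h mu g kap b0 rho y0 D B y ->
  forall t, adversary_invariant kap kap' b0 rho (ln y0) D B y t.
Proof.
move=> hmin0 hm g0 b0c rho0 k0 kk krho y00 x04 small big adv.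
have s0 := sqrt3_gt0 R; have ss := sqrt3_sqr R; have /andP[sl su] := sqrt3_bounds R.
have b02 : 2 <= b0 by move: b0c sl; clear; lra.
case: (adv) => yE DE BE step.
have kapp : 0 < kap := lt_le_trans k0 kk.
elim=> [|t [[i1 i2 i3 i4] [i5 i6 i7 i8] /andP[i9 i10] /andP[i11 i12]]].
  have E q : 0 <= q -> kap' * expR (D 0%N - B 0%N * q) <= kap'.
    move=> q0; rewrite ler_piMr //; first exact: ltW.
    by rewrite expR_le1 DE BE sub0r oppr_le0 mulr_ge0 // ltW // (lt_le_trans _ b02).
  rewrite /adversary_invariant /= yE (gtr0_norm y00); split.
  - by split => //; move: x04 sl su; nra.
  - split => //.
    + by rewrite divr_gt0.
    + by apply: (le_trans (E _ _)); [rewrite divr_ge0 //; move: x04; clear; lra | move: krho rho0; clear; lra].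
    + by apply: (le_trans (E _ _)) => //; rewrite divr_ge0 //; move: x04; clear; lra.
  - by rewrite DE subrr lexx.
  - by rewrite BE addrK lexx.
move: i1 i2 i3 i4 i5 i6 i7 i8 i10 i12.
set x := log_levels y; set e := slacks kap rho D B y => i1 i2 i3 i4 i5 i6 i7 i8 i10 i12.
have et0 : 0 < e t by move: i5 i6; clear; lra.
have x1 : 1 <= x t by move: i1 x04; clear; lra.
have xs1 : x t <= x t.+1.
  by apply: le_trans i2; rewrite ler_peMl //; [move: x1 | move: sl]; clear; lra.
have x1' : 1 <= x t.+1 := le_trans x1 xs1.
have xs2 : x t.+1 <= x t.+2.
  by apply: le_trans i3; rewrite ler_peMl //; [move: x1' | move: sl]; clear; lra.
have xt2E : x t.+2 = ln `|y t| by [].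
have yt0 : y t != 0.
  have : 0 < x t.+2 by move: i4 x04; clear; lra.
  by apply: contraTneq => y0E; rewrite xt2E y0E normr0 ln0 // ltxx.
have := adversarial_tilt adv et0 x1'; rewrite -/x -/e.
move=> [sig [/andP[sg0 sge] D' B' /andP[sx0 sxs] rot]].
have D'rho : D t.+1 <= rho - e t / 2 by rewrite D'; move: i10 sge; clear; lra.
have B'b0 : b0 <= B t.+1 by rewrite B'; move: i11 sx0; clear; lra.
have B'rho : B t.+1 <= b0 + rho - e t / 2.
  by rewrite B'; move: i12 sge sxs; clear; lra.
have e2E : e t.+2 = kap * expR (D t.+1 - B t.+1 * x t.+2) by [].
have e20 : 0 < e t.+2 by rewrite e2E mulr_gt0 // expR_gt0.
have rotX : B t.+1 * x t.+1 - D t.+1 = B t * x t.+1 - D t.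
  by rewrite rot subrr mulr0 addr0.
have half : e t.+2 <= e t.+1 / 2.
  have [t0|[s tE]] : t = 0%N \/ exists s, t = s.+1.
      by case: (t) => [|s]; [left | right; exists s].
    have -> : e t.+1 = rho / 2 by rewrite t0.
    have xE : x t.+2 = ln y0 by rewrite xt2E t0 yE gtr0_norm.
    rewrite e2E xE.
    apply: (@le_trans _ _ (kap * expR (rho - b0 * ln y0))); last first.
      by move: small; clear; lra.
    apply: ler_wpM2l; first exact: ltW.
    rewrite ler_expR; apply: lerB.
      by apply: (le_trans D'rho); move: et0; clear; lra.
    by apply: ler_wpM2r => //; move: x04; clear; lra.
  have e1E : e t.+1 = kap * expR (D t - B t * x t.+1) by rewrite tE.
  rewrite e2E e1E.
  have -> : D t.+1 - B t.+1 * x t.+2 =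
      D t - B t * x t.+1 - B t.+1 * (x t.+2 - x t.+1).
    by move: rotX; rewrite mulrBr; clear; lra.
  rewrite expRD -[leRHS]mulrA; apply: ler_wpM2l; first exact: ltW.
  apply: ler_wpM2l; first exact: expR_ge0.
  rewrite expRN lef_pV2 ?posrE ?expR_gt0 //.
  apply: le_trans (expR_ge1Dx _).
  have g1 : 1 / 2 <= x t.+2 - x t.+1.
    have : 17 / 10 * x t.+1 <= Num.sqrt 3 * x t.+1.
      by apply: ler_wpM2r; [move: x1' | move: sl]; clear; lra.
    by move: i3 x1'; clear; lra.
  have : 2 * (1 / 2) <= B t.+1 * (x t.+2 - x t.+1).
    by apply: ler_pM => //; exact: le_trans B'b0.
  by clear; lra.
have [_ _ force0 force1] := step t.
have grow : Num.sqrt 3 * x t.+2 <= x t.+3.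
  have xt0 : 0 <= x t := le_trans ler01 x1.
  apply: (level_growth b0c i11 xt0 i2 i3 (C := - ln (`|g| * hmin * kap' / 8))).
    apply: (le_trans big); apply: ler_wpM2l => //.
    by move: b0c; clear; lra.
  have gap : B t * ln `|y t| - D t + e t / 4 <=
      (B t + e t / 2 / x t.+1) * ln `|y t| - (D t + e t / 2).
    rewrite -xt2E mulrDl.
    have -> : e t / 2 / x t.+1 * x t.+2 = e t / 2 + e t / 2 * ((x t.+2 - x t.+1) / x t.+1).
      by field; rewrite gt_eqF // (lt_le_trans _ x1').
    have q : 1 / 2 <= (x t.+2 - x t.+1) / x t.+1.
      rewrite ler_pdivlMr ?(lt_le_trans _ x1') //.
      have : 17 / 10 * x t.+1 <= Num.sqrt 3 * x t.+1.
        by apply: ler_wpM2r; [move: x1' | move: sl]; clear; lra.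
      by move: i3 x1'; clear; lra.
    have : e t / 2 * (1 / 2) <= e t / 2 * ((x t.+2 - x t.+1) / x t.+1).
      by apply: ler_wpM2l => //; rewrite divr_ge0 // ltW.
    by clear; lra.
  have e40 : 0 <= e t / 4 by rewrite divr_ge0 // ltW.
  have F := forced_response yt0 (ltW hmin0) (hm (y t)) e40 gap force0 force1.
  have c10 : 0 < `|g| * hmin * kap' / 8 by rewrite !mulr_gt0 // ?normr_gt0 // invr_gt0.
  rewrite opprK.
  have xt3E : x t.+3 = ln `|y t.+1| by [].
  have low : (`|g| * hmin * kap' / 8) * expR (B t * (x t.+2 - x t)) <= `|y t.+1|.
    apply: le_trans F; rewrite -xt2E.
    have -> : `|g| * hmin * expR (B t * x t.+2 - D t) * (e t / 4) / 2 =
       `|g| * hmin / 8 * expR (B t * x t.+2 - D t) * e t by field.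
    have -> : `|g| * hmin * kap' / 8 * expR (B t * (x t.+2 - x t)) =
       `|g| * hmin / 8 * expR (B t * x t.+2 - D t) * (kap' * expR (D t - B t * x t)).
      have -> : B t * (x t.+2 - x t) = (B t * x t.+2 - D t) + (D t - B t * x t) by ring.
      by rewrite (expRD (B t * x t.+2 - D t)); ring.
    by apply: ler_wpM2l => //; rewrite !mulr_ge0 ?expR_ge0 ?normr_ge0 // ltW.
  rewrite xt3E -ler_expR lnK; last first.
    rewrite posrE; apply: lt_le_trans low.
    by rewrite mulr_gt0 ?expR_gt0.
  by rewrite [leLHS]expRD lnK ?posrE // mulrC.
have x3big : ln y0 <= x t.+3.
  apply: (le_trans i4); apply: le_trans grow; rewrite ler_peMl //.
    by move: i4 x04; clear; lra.
  by move: sl; clear; lra.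
rewrite /adversary_invariant -/x -/e; split.
- by split => //; exact: le_trans xs1.
- split => //.
  + have -> : D t.+1 - B t.+1 * x t.+1 = D t - B t * x t.+1.
      by move: rotX; clear; lra.
    exact: i8.
  + by rewrite e2E; apply: ler_wpM2r => //; exact: expR_ge0.
- apply/andP; split; first by rewrite D'; move: i9 sg0; clear; lra.
  by move: D'rho i6; clear; lra.
- apply/andP; split => //.
  by move: B'rho i6; clear; lra.
Qed.

Lemma cvgn_within (R : realType) (u : nat -> R) (l lo hi : R) (N : nat) :
  u @ \oo --> l -> (forall n, (N <= n)%N -> lo <= u n <= hi) -> lo <= l <= hi.
Proof.
move=> ul bd; rewrite -(cvg_lim (@Rhausdorff R) ul).
have cu : cvgn u by apply: cvgP ul.
by apply/andP; split; [apply: limr_ge | apply: limr_le] => //;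
  exists N => // n /= /bd /andP[].
Qed.

(** For a fixed time s, the log-gain at ln |y s| is preserved by the rotation at
    time s + 1, of which it is the pivot, and decreases from then on, all later
    pivots being larger.  The decrements are at most half the slacks, and each
    slack is at most half the previous one, so the sum of the decrements stays
    below the slack attached to s. *)
Lemma adversarial_limit (R : realType) (h : R -> R) (mu : feedback_law R)
    (g kap kap' b0 rho y0 : R) (D B y : nat -> R) :
  4 <= ln y0 -> adversarial h mu g kap b0 rho y0 D B y ->
  (forall t, adversary_invariant kap kap' b0 rho (ln y0) D B y t) ->
  0 < rho ->
  exists d b : R, [/\ 0 <= d <= rho, b0 <= b <= b0 + rho & forall s,
    B s.+1 * ln `|y s| - D s.+1 - slacks kap rho D B y s.+2 <=
      b * ln `|y s| - d <= B s.+1 * ln `|y s| - D s.+1].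
Proof.
move=> x04 adv inv rho0.
have s0 := sqrt3_gt0 R; have /andP[sl su] := sqrt3_bounds R.
have tilt t := @adversarial_tilt _ _ _ _ _ _ _ _ _ _ _ t adv.
set x := log_levels y in tilt *; set e := slacks kap rho D B y in tilt *.
have ep t : 0 < e t.
  by case: t => [//|t]; have [_ [i5 _ _ _] _ _] := inv t; exact: i5.
have ehalf t : e t.+1 <= e t / 2 by have [_ [_ i6 _ _] _ _] := inv t; exact: i6.
have x1 t : 1 <= x t.
  by have [[i1 _ _ _] _ _ _] := inv t; move: i1 x04; rewrite -/x; clear; lra.
have xS t : x t <= x t.+1.
  have [[_ i2 _ _] _ _ _] := inv t; apply: le_trans i2; rewrite ler_peMl //.
    exact: le_trans (x1 t).
  by move: sl; clear; lra.
have xmono : {homo x : m n / (m <= n)%N >-> m <= n}.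
  by apply: homo_leq => // m n p; exact: le_trans.
have Dn : nondecreasing_seq D.
  apply/nondecreasing_seqP => t.
  have [sig [/andP[sg0 _] -> _ _ _]] := tilt t (ep t) (x1 t.+1).
  by rewrite lerDl.
have Bn : nondecreasing_seq B.
  apply/nondecreasing_seqP => t.
  have [sig [_ _ -> /andP[sx0 _] _]] := tilt t (ep t) (x1 t.+1).
  by rewrite lerDl.
have Db t : 0 <= D t <= rho.
  have [_ _ /andP[i9 i10] _] := inv t; rewrite i9 (le_trans i10) //.
  by rewrite gerBl ltW // ep.
have Bb t : b0 <= B t <= b0 + rho.
  have [_ _ _ /andP[i9 i10]] := inv t; rewrite i9 (le_trans i10) //.
  by rewrite gerBl ltW // ep.
have cD : D @ \oo --> limn D.
  apply: nondecreasing_is_cvgn => //.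
  by exists rho => _ [t _ <-]; have /andP[] := Db t.
have cB : B @ \oo --> limn B.
  apply: nondecreasing_is_cvgn => //.
  by exists (b0 + rho) => _ [t _ <-]; have /andP[] := Bb t.
exists (limn D), (limn B); split.
- by apply: (cvgn_within cD (N := 0%N)) => n _; exact: Db.
- by apply: (cvgn_within cB (N := 0%N)) => n _; exact: Bb.
move=> s; have zE : ln `|y s| = x s.+2 by [].
rewrite zE; set z := x s.+2.
have z0 : 0 <= z := le_trans ler01 (x1 _).
have cF : (fun t => B t * z - D t) @ \oo --> limn B * z - limn D.
  by apply: cvgB => //; apply: cvgMl.
suff H n : B s.+1 * z - D s.+1 - e s.+2 + e (s.+2 + n)%N <=
    B (s.+2 + n)%N * z - D (s.+2 + n)%N <= B s.+1 * z - D s.+1.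
  apply: (cvgn_within cF (N := s.+2)) => n /subnKC <-.
  have /andP[h1 ->] := H (n - s.+2)%N; rewrite andbT; apply: le_trans h1.
  by rewrite lerDl ltW // ep.
elim: n => [|n /andP[IH1 IH2]].
  rewrite addn0.
  have [sig [_ _ _ _ ->]] := tilt s.+1 (ep _) (x1 _).
  by rewrite subrr mulr0 addr0 subrK lexx.
rewrite addnS; set m := (s.+2 + n)%N in IH1 IH2 *.
have [sig [/andP[sg0 sge] _ _ /andP[sx0 sxs] ->]] := tilt m (ep _) (x1 _).
have X1 := x1 m.+1.
have zX : z <= x m.+1 by apply: xmono; rewrite /m; apply: leqW; exact: leq_addr.
have t1 : sig / x m.+1 * (z - x m.+1) <= 0.
  by apply: mulr_ge0_le0 => //; rewrite subr_le0.
have t2 : - sig <= sig / x m.+1 * (z - x m.+1).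
  have : 0 <= sig / x m.+1 * z by rewrite mulr_ge0.
  by rewrite mulrBr divfK ?gt_eqF ?(lt_le_trans _ X1) //; clear; lra.
have eh := ehalf m.
by apply/andP; split; move: IH1 IH2 t1 t2 eh sge; clear; lra.
Qed.

(** The value of kap is such that an error of kap exp (- f) on a log-gain f changes
    the response by at most W. *)
Lemma adversary_wins (R : realType) (W : R) (h : R -> R) (hmin hmax : R)
    (mu : feedback_law R) (g b0 rho R0 : R) :
  0 < W -> 0 < hmin -> (forall z, hmin <= h z <= hmax) -> g != 0 ->
  3 * Num.sqrt 3 / 2 < b0 -> 0 < rho ->
  exists d b y0 w y,
    [/\ [/\ 0 <= d <= rho & b0 <= b <= b0 + rho],
        R0 <= y0, admissible_disturbance W w,
        y 0%N = y0 /\ closed_loop h mu (g * expR (- d), b) w y &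
        exists2 c : R, 0 < c & forall t, c * Num.sqrt 3 ^+ t <= ln `|y t|].
Proof.
move=> W0 hmin0 hb g0 b0c rho0.
have s0 := sqrt3_gt0 R; have /andP[sl su] := sqrt3_bounds R.
have hmax0 : 0 < hmax.
  by have /andP[u v] := hb 0; exact: lt_le_trans hmin0 (le_trans u v).
have ng0 : 0 < `|g| by rewrite normr_gt0.
pose kap := W / (`|g| * hmax).
have kap0 : 0 < kap by rewrite divr_gt0 // mulr_gt0.
pose kap' := Num.min kap (rho / 2).
have kap'0 : 0 < kap' by rewrite lt_min kap0 divr_gt0.
have kap'k : kap' <= kap by rewrite ge_min lexx.
have kap'r : kap' <= rho / 2 by rewrite ge_min lexx orbT.
have b01 : 1 <= b0 by move: b0c sl; clear; lra.
have q0 : 0 < 2 * b0 / 3 - Num.sqrt 3 by move: b0c; clear; lra.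
pose C := - ln (`|g| * hmin * kap' / 8).
have [x0 [x04 xR xsmall xC]] : exists x0 : R, [/\ 4 <= x0, R0 <= expR x0,
    kap * expR (rho - b0 * x0) <= rho / 4
  & C <= (2 * b0 / 3 - Num.sqrt 3) * x0].
  pose L := rho - ln (rho / 4 / kap).
  pose x0 := 4 + `|R0| + `|L| + `|C / (2 * b0 / 3 - Num.sqrt 3)|.
  have n1 := normr_ge0 R0; have n2 := normr_ge0 L.
  have n3 := normr_ge0 (C / (2 * b0 / 3 - Num.sqrt 3)).
  have a1 := ler_norm R0; have a2 := ler_norm L.
  have a3 := ler_norm (C / (2 * b0 / 3 - Num.sqrt 3)).
  have x0E : x0 = 4 + `|R0| + `|L| + `|C / (2 * b0 / 3 - Num.sqrt 3)| by [].
  clearbody x0; exists x0; split.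
  - by move: x0E n1 n2 n3; clear; lra.
  - apply: le_trans (expR_ge1Dx x0).
    by move: x0E n1 n2 n3 a1; clear; lra.
  - have Lx : L <= x0 by move: x0E n1 n2 n3 a2; clear; lra.
    have x00 : 0 <= x0 by move: x0E n1 n2 n3; clear; lra.
    have xb : x0 <= b0 * x0 by rewrite ler_peMl.
    have r0 : 0 < rho / 4 / kap by do 2 (apply: divr_gt0 => //).
    rewrite [leLHS]mulrC -ler_pdivlMr // -[leRHS]lnK ?posrE // ler_expR.
    by move: Lx xb; rewrite /L; clear; lra.
  - rewrite [leRHS]mulrC -ler_pdivrMr //.
    by move: x0E n1 n2 n3 a3; clear; lra.
pose y0 := expR x0.
have y00 : 0 < y0 := expR_gt0 _.
have lny0 : ln y0 = x0 by rewrite /y0 expRK.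
have [D [B [y adv]]] := adversarial_exists h mu g kap b0 rho y0.
have hm z : hmin <= h z by have /andP[] := hb z.
have inv := adversary_invariantP hmin0 hm g0 b0c rho0 kap'0 kap'k kap'r y00.
rewrite lny0 in inv; have {}inv := inv _ _ _ _ x04 xsmall xC adv.
have [yE _ _ step] := adv.
have := @adversarial_limit _ _ _ _ _ kap' _ _ _ _ _ _ _ adv.
rewrite lny0 => /(_ x04 inv rho0) [d [b [dB bB lim]]].
pose w t := if t is s.+1 then
  y s.+1 - g * expR (- d) * h (y s) * phi b (y s) - mu s (fun i : 'I_s.+1 => y i)
  else 0.
have level t : x0 <= ln `|y t| /\ Num.sqrt 3 * ln `|y t| <= ln `|y t.+1|.
  by have [[_ _ _ i4] _ _ _] := inv t; have [[_ _ i3 _] _ _ _] := inv t.+1.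
have ynz t : y t != 0.
  have : 0 < ln `|y t| by have [] := level t; move: x04; clear; lra.
  by apply: contraTneq => ->; rewrite normr0 ln0 // ltxx.
exists d, b, y0, w, y; split => //.
- case=> // s _ /=.
  have [-> _ _ _] := step s.
  set u := mu s _.
  have -> : response h g (D s.+1) (B s.+1) (y s) + u
      - g * expR (- d) * h (y s) * phi b (y s) - u =
     response h g (D s.+1) (B s.+1) (y s) - response h g d b (y s).
    by rewrite /response; ring.
  rewrite !responseE // -mulrBr !normrM normr_sg ynz mulr1.
  have /andP[l1 l2] := lim s.
  move: l1 l2; rewrite [slacks _ _ _ _ _ _]/=.
  have -> : D s.+1 - B s.+1 * ln `|y s| = - (B s.+1 * ln `|y s| - D s.+1) by ring.
  set f := B s.+1 * _ - _; set f' := b * _ - _ => l1 l2.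
  have hs0 : 0 <= h (y s) := le_trans (ltW hmin0) (hm _).
  have /andP[_ hM] := hb (y s).
  have fd : 0 <= expR f - expR f' by rewrite subr_ge0 ler_expR.
  rewrite (ger0_norm hs0) (ger0_norm fd).
  have key : expR f - expR f' <= kap.
    have t1 := ler_wpM2l (expR_ge0 f) (expR_ge1Dx (f' - f)).
    rewrite -expRD subrKC in t1.
    have t2 : expR f * (f - f') <= expR f * (kap * expR (- f)).
      by apply: ler_wpM2l; [exact: expR_ge0 | move: l1; clear; lra].
    rewrite mulrCA expRxMexpNx_1 mulr1 in t2.
    by move: t1 t2; clear; lra.
  apply: (@le_trans _ _ (`|g| * hmax * kap)).
    apply: ler_pM => //; first by rewrite mulr_ge0.
    by apply: ler_wpM2l.
  by rewrite /kap mulrC divfK // gt_eqF // mulr_gt0.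
- split => // t /=; set u := mu t _.
  by rewrite /w; ring.
- exists x0; first by move: x04; clear; lra.
  elim=> [|t IH]; first by rewrite expr0 mulr1; have [] := level 0%N.
  rewrite exprS mulrCA; have [_ l] := level t; apply: le_trans l.
  by apply: ler_wpM2l => //; exact: ltW.
Qed.

(** * Assembling the three claims *)

Lemma sup_abs_geometric (R : realType) (c : R) (y : nat -> R) : 0 < c ->
  (forall t, c * Num.sqrt 3 ^+ t <= ln `|y t|) -> sup_abs y = +oo%E.
Proof.
move=> c0 cy; have /andP[sl su] := sqrt3_bounds R.
have lin t : c * (t%:R / 2) <= c * Num.sqrt 3 ^+ t.
  apply: ler_wpM2l; first exact: ltW.
  elim: t => [|t IH]; first by rewrite mul0r expr0 ler01.
  have one : 1 <= Num.sqrt 3 ^+ t :> R by rewrite exprn_ege1 //; move: sl; clear; lra.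
  have : 3 / 2 * Num.sqrt 3 ^+ t <= Num.sqrt 3 * Num.sqrt 3 ^+ t :> R.
    by apply: ler_wpM2r; [move: one | move: sl]; clear; lra.
  have tS : t.+1%:R = t%:R + 1 :> R by rewrite natr1.
  by rewrite exprS tS; move: IH one; clear; lra.
apply/eqyP => A A0.
have [t At] : exists t : nat, A <= c * (t%:R / 2).
  exists (Num.Def.archi_bound (2 * (A / c))).
  have : 2 * (A / c) < (Num.Def.archi_bound (2 * (A / c)))%:R.
    by apply: archi_boundP; rewrite mulr_ge0 // divr_ge0 // ltW.
  set n := Num.Def.archi_bound _ => h; rewrite [leRHS]mulrC -ler_pdivrMr //.
  by move: h; clear; lra.
apply: le_ereal_sup_tmp; exists (`|y t|%:E); first by exists t.
rewrite lee_fin.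
have l : A <= ln `|y t| := le_trans At (le_trans (lin t) (cy t)).
have y0 : 0 < `|y t|.
  rewrite normr_gt0; apply: contraTneq l => ->.
  by rewrite normr0 ln0 // -ltNge.
apply: (le_trans l); apply/ltW; exact: ln_sublinear.
Qed.

Lemma nbhs_box (R : realType) (Q : set (R * R)) (p0 : R * R) : nbhs p0 Q ->
  exists2 e : R, 0 < e & forall p : R * R,
    `|p.1 - p0.1| < e -> `|p.2 - p0.2| < e -> Q p.
Proof.
move=> /nbhs_ballP[e e0 eQ]; exists e => // p h1 h2.
by apply: eQ; split; rewrite -ball_normE /= distrC.
Qed.

Lemma box_nbhs (R : realType) (Q : set (R * R)) (p0 : R * R) (e : R) : 0 < e ->
  (forall p : R * R, `|p.1 - p0.1| < e -> `|p.2 - p0.2| < e -> Q p) -> nbhs p0 Q.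
Proof.
move=> e0 eQ; apply/nbhs_ballP; exists e => // p [h1 h2].
by apply: eQ; rewrite distrC; [move: h1 | move: h2]; rewrite -ball_normE.
Qed.

(** With a vanishing gain the response does not depend on the exponent, so when
    p0.1 = 0 the adversary starts from a nearby nonzero gain. *)
Lemma destabilized_near (R : realType) (W : R) (h : R -> R) (hmin hmax : R)
    (Q : set (R * R)) (p0 : R * R) (mu : feedback_law R) (R0 : R) :
  0 < W -> 0 < hmin -> (forall z, hmin <= h z <= hmax) ->
  nbhs p0 Q -> 3 * Num.sqrt 3 / 2 < p0.2 ->
  exists (p : R * R) (y0 : R) (w y : nat -> R),
    [/\ Q p, R0 <= y0, admissible_disturbance W w,
        y 0%N = y0 /\ closed_loop h mu p w y &
        exists2 c : R, 0 < c & forall t, c * Num.sqrt 3 ^+ t <= ln `|y t|].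
Proof.
move=> W0 hmin0 hb /nbhs_box[e e0 eQ] bc.
pose g := if p0.1 == 0 then e / 2 else p0.1.
have e20 : 0 < e / 2 by rewrite divr_gt0.
have g0 : g != 0 by rewrite /g; case: ifPn => // _; rewrite gt_eqF.
have gp : `|g - p0.1| <= e / 2.
  rewrite /g; case: ifPn => [/eqP ->|_]; last by rewrite subrr normr0 ltW.
  by rewrite subr0 gtr0_norm.
have ng0 : 0 <= `|g| by [].
have gE : 0 < 4 * (`|g| + 1) by rewrite mulr_gt0 // ltr_wpDl.
pose rho := e / (4 * (`|g| + 1)).
have rho0 : 0 < rho by rewrite divr_gt0.
have rhoE : rho * (4 * (`|g| + 1)) = e by rewrite divfK // gt_eqF.
have [d [b [y0 [w [y [[/andP[d0 dr] /andP[b0 br]] yR aw cl gr]]]]]] :=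
  adversary_wins mu R0 W0 hmin0 hb g0 bc rho0.
have gr0 : 0 <= `|g| * rho by rewrite mulr_ge0 // ltW.
exists (g * expR (- d), b), y0, w, y; split => //.
apply: eQ => /=; last first.
  rewrite ger0_norm ?subr_ge0 //.
  by move: br rho0 rhoE gr0; clear; lra.
have -> : g * expR (- d) - p0.1 = (g - p0.1) - g * (1 - expR (- d)) by ring.
apply: (le_lt_trans (ler_normB _ _)); rewrite normrM.
have : `|g| * `|1 - expR (- d)| <= `|g| * rho.
  apply: ler_wpM2l => //.
  have := expR_ge1Dx (- d) => t1.
  have t2 : expR (- d) <= 1 by rewrite expR_le1 oppr_le0.
  by rewrite ger0_norm ?subr_ge0 //; move: t1 dr; clear; lra.
by move: gp gr0 rho0 rhoE e0; clear; lra.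
Qed.

Lemma stabilizable_below (R : realType) (W : R) (h : R -> R) (hmin hmax : R)
    (P : set (R * R)) :
  0 < W -> 0 < hmin -> (forall z, hmin <= h z <= hmax) ->
  P !=set0 -> compact P -> P `<=` param_space (R := R) ->
  (forall p, P p -> p.2 <= 3 * Num.sqrt 3 / 2) ->
  robustly_stabilizable W h P.
Proof.
move=> W0 hmin0 hb P0 cP Pb Pc.
exists (largest_exponent_law W h P) => p y0 w y Pp aw _ cl.
have [B yB] := largest_exponent_law_bounds (ltW W0) hmin0 hb P0 cP Pb Pc (normr_ge0 (y 0%N)).
apply: (@le_lt_trans _ _ B%:E); last exact: ltry.
by apply/sup_abs_le/yB; split => //; exists p, w.
Qed.

Theorem corollary3p6 (R : realType) (W : R) (W_gt0 : 0 < W)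
    (h : R -> R) (h_cont : continuous h) (h_gt0 : forall y : R, 0 < h y)
    (hmin hmax : R) (hmin_gt0 : 0 < hmin)
    (h_bounds : forall y : R, hmin <= h y <= hmax) :
  [/\ (forall P : set (R * R),
         P !=set0 -> compact P -> P `<=` param_space (R := R) ->
         (forall p : R * R, P p -> p.2 <= 3 * Num.sqrt 3 / 2) ->
         exists mu : feedback_law R, forall Y : R, 0 <= Y ->
           (ereal_sup [set sup_abs y | y in trajectories W h mu P Y] < +oo)%E),
      (forall p0 : R * R, param_space p0 ->
         (locally_robustly_stabilizable W h p0 <-> p0.2 < 3 * Num.sqrt 3 / 2))
    & (forall p0 : R * R, param_space p0 -> 3 * Num.sqrt 3 / 2 < p0.2 ->
       forall Q : set (R * R),
         compact_rectangle Q -> Q `<=` param_space (R := R) -> interior Q p0 ->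
       forall (mu : feedback_law R) (R0 : R), 0 < R0 ->
       exists (p : R * R) (y0 : R) (w y : nat -> R),
         [/\ Q p, R0 <= y0, admissible_disturbance W w,
             y 0%N = y0 /\ closed_loop h mu p w y &
             (exists (c z : R) (T0 : nat),
                [/\ 0 < c, 1 < z &
                    forall t : nat, (T0 <= t)%N -> c * z ^+ t <= ln `|y t|])
             /\ sup_abs y = +oo%E])].
Proof.
split.
- move=> P P0 cP Pb Pc; exists (largest_exponent_law W h P) => Y Y0.
  have [B yB] := largest_exponent_law_bounds (ltW W_gt0) hmin_gt0 h_bounds P0 cP Pb Pc Y0.
  apply: (@le_lt_trans _ _ B%:E); last exact: ltry.
  by apply: ge_ereal_sup => _ [y ty <-]; apply/sup_abs_le/yB.
- move=> [a0 b0] b00; rewrite /param_space /= in b00; split.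
    move=> [Q [_ _ Qp [mu stab]]].
    rewrite ltNge; apply/negP => /= bc.
    have [e e0 eQ] := nbhs_box Qp.
    have Qp' : nbhs (a0, b0 + e / 2) Q.
      apply: (@box_nbhs _ _ _ (e / 2)); first by rewrite divr_gt0.
      move=> p /= h1 h2; apply: eQ => /=; first by move: h1 e0; clear; lra.
      rewrite (_ : p.2 - b0 = (p.2 - (b0 + e / 2)) + e / 2); last by ring.
      apply: (le_lt_trans (ler_normD _ _)).
      by rewrite (@gtr0_norm _ (e / 2)) ?divr_gt0 //; move: h2; clear; lra.
    have bc' : 3 * Num.sqrt 3 / 2 < b0 + e / 2 by move: bc e0; clear; lra.
    have [p [y0 [w [y [Qpp _ aw [y0E cl] [c c0 cy]]]]]] :=
      destabilized_near mu 1 W_gt0 hmin_gt0 h_bounds Qp' bc'.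
    by have := stab p y0 w y Qpp aw y0E cl; rewrite (sup_abs_geometric c0 cy) ltxx.
  move=> /= bc.
  pose Q : set (R * R) := `[a0 - 1, a0 + 1] `*` `[b0 / 2, (b0 + 3 * Num.sqrt 3 / 2) / 2].
  have Qpos : Q `<=` param_space (R := R).
    by move=> p [_ /=]; rewrite in_itv /= /param_space /= => /andP[u _]; move: u b00; clear; lra.
  exists Q; split => //.
  + exists (a0 - 1), (a0 + 1), (b0 / 2), ((b0 + 3 * Num.sqrt 3 / 2) / 2).
    by split => //; move: b00 bc; clear; lra.
  + apply: (@box_nbhs _ _ _ (Num.min 1 (Num.min (b0 / 2) ((3 * Num.sqrt 3 / 2 - b0) / 2)))).
      by rewrite !lt_min ltr01 /=; apply/andP; split; move: b00 bc; clear; lra.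
    move=> p /=; rewrite !lt_min => /andP[h1 _] /and3P[_ h2 h3].
    move: h1 h2 h3; rewrite !ltr_norml => /andP[u1 u2] /andP[v1 v2] /andP[w1 w2].
    by split => /=; rewrite in_itv /=; apply/andP; split;
      [move: u1 | move: u2 | move: v1 | move: w2]; clear; lra.
  + apply: (stabilizable_below W_gt0 hmin_gt0 h_bounds) => //.
    * by exists (a0, b0); split => /=; rewrite in_itv /=; apply/andP; split;
        move: b00 bc; clear; lra.
    * by apply: compact_setX; exact: segment_compact.
    * by move=> p [_ /=]; rewrite in_itv /= => /andP[_ u]; move: u bc; clear; lra.
- move=> p0 _ bc Q _ _ Qp mu R0 _.
  have [p [y0 [w [y [Qpp yR aw cl [c c0 cy]]]]]] :=
    destabilized_near mu R0 W_gt0 hmin_gt0 h_bounds Qp bc.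
  exists p, y0, w, y; split => //; split; last exact: sup_abs_geometric c0 cy.
  exists c, (Num.sqrt 3), 0%N; split => //.
  by have /andP[sl _] := sqrt3_bounds R; move: sl; clear; lra.
Qed.
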